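(* Let $p>2$, $\lambda\in(0,1)$, and let $\Omega\subset\mathbb{R}^n$ be open and bounded with $\mathcal{C}^2$ boundary. Let $f\in\mathcal{C}(\overline\Omega)$ be nonnegative, with compact support contained in $\Omega$, and semiconcave in $\Omega$. Let $u$ and $u^\varepsilon$ be the viscosity solutions of the state-constraint problems $(\mathrm{SC}_0)$ and $(\mathrm{SC}_\varepsilon)$. Then for every $\varepsilon>0$ sufficiently small, $$\max_{x\in\overline\Omega}\{u^\varepsilon(x)-u(x)\}\ \le\ \Big(\frac1\lambda+\frac{2^{\alpha_p}}{\alpha_p}\Big)\varepsilon^{1-\frac{\alpha_p}{2}},\qquad \alpha_p=\frac{p-2}{p-1}.$$
   Context: A function $f:\Omega\to\mathbb R$ is semiconcave (with linear modulus, constant $K$) if for all $x,y$ with segment $[x,y]\subset\Omega$ and all $t\in[0,1]$: $tf(x)+(1-t)f(y)-f(tx+(1-t)y)\le t(1-t)\frac{K|x-y|^2}{2}$. For $\varepsilon\ge0$, a viscosity solution of the state-constraint problem $(\mathrm{SC}_\varepsilon)$: $\lambda u+|Du|^p-\varepsilon\Delta u=f$ in $\Omega$, $\lambda u+|Du|^p-\varepsilon\Delta u\ge f$ on $\partial\Omega$, is a function $u\in\mathcal{C}(\overline\Omega)$ which is a viscosity subsolution in $\Omega$ (for every $\varphi\in\mathcal C^2$ ($\mathcal C^1$ if $\varepsilon=0$) with $u-\varphi$ having a local maximum at $x_0\in\Omega$: $\lambda u(x_0)+|D\varphi(x_0)|^p-\varepsilon\Delta\varphi(x_0)\le f(x_0)$)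 and a viscosity supersolution on $\overline\Omega$ (for every such $\varphi$ with $u-\varphi$ having a local minimum relative to $\overline\Omega$ at $x_0\in\overline\Omega$: $\ge f(x_0)$). Such solutions exist and are unique; for $\varepsilon>0$, $u^\varepsilon\in\mathcal C^2(\Omega)\cap\mathcal C(\overline\Omega)$. *)

(* Defs.v *)
From HB Require Import structures.
From mathcomp Require Import all_boot all_order all_algebra.
From mathcomp Require Import all_classical all_reals all_analysis.
Set Implicit Arguments. Unset Strict Implicit. Unset Printing Implicit Defensive.
Import Order.TTheory GRing.Theory Num.Theory.
Import numFieldNormedType.Exports.
Local Open Scope classical_set_scope.
Local Open Scope ring_scope.

Section Defs.
Variables (R : realType) (n : nat).
Notation V := 'rV[R]_n.

(* Euclidean norm (the library norm on 'rV is the max norm) *)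
Definition enorm (v : V) : R := Num.sqrt (\sum_(i < n) v 0 i ^+ 2).

Definition evec (i : 'I_n) : V := delta_mx 0 i.

Definition partial (g : V -> R) (i : 'I_n) : V -> R := fun x => 'D_(evec i) g x.

Definition C1_on (O : set V) (g : V -> R) : Prop :=
  forall i : 'I_n, forall x, O x ->
    derivable g x (evec i) /\ {for x, continuous (partial g i)}.

Definition C2_on (O : set V) (g : V -> R) : Prop :=
  C1_on O g /\ forall i : 'I_n, C1_on O (partial g i).

Definition grad (g : V -> R) (x : V) : V := \row_(i < n) partial g i x.

Definition lap (g : V -> R) (x : V) : R := \sum_(i < n) partial (partial g i) i x.

Definition C2_boundary (O : set V) : Prop :=
  forall x0, closure O x0 -> ~ O x0 ->
    exists r : R, 0 < r /\ exists rho : V -> R,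
      C2_on [set x | enorm (x - x0) < r] rho /\
      (forall x, enorm (x - x0) < r -> grad rho x != 0) /\
      (forall x, enorm (x - x0) < r -> (O x <-> rho x < 0)).

Definition support_in (O : set V) (f : V -> R) : set V :=
  closure [set x | closure O x /\ f x != 0].

Definition semiconcave_on (O : set V) (f : V -> R) : Prop :=
  exists K : R, forall x y : V,
    (forall s : R, 0 <= s <= 1 -> O (s *: x + (1 - s) *: y)) ->
    forall t : R, 0 <= t <= 1 ->
      t * f x + (1 - t) * f y - f (t *: x + (1 - t) *: y)
        <= t * (1 - t) * (K * enorm (x - y) ^+ 2 / 2).

Definition test_fun (eps : R) (phi : V -> R) : Prop :=
  if eps == 0 then C1_on setT phi else C2_on setT phi.

Definition SC_op (lam p eps : R) (ux : R) (phi : V -> R) (x : V) : R :=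
  lam * ux + (enorm (grad phi x)) `^ p - eps * lap phi x.

Definition SC_solution (O : set V) (lam p eps : R) (f u : V -> R) : Prop :=
  {within closure O, continuous u} /\
  (forall (phi : V -> R) (x0 : V), test_fun eps phi -> O x0 ->
     (exists r : R, 0 < r /\ forall x, O x -> enorm (x - x0) < r ->
         u x - phi x <= u x0 - phi x0) ->
     SC_op lam p eps (u x0) phi x0 <= f x0) /\
  (forall (phi : V -> R) (x0 : V), test_fun eps phi -> closure O x0 ->
     (exists r : R, 0 < r /\ forall x, closure O x -> enorm (x - x0) < r ->
         u x0 - phi x0 <= u x - phi x) ->
     f x0 <= SC_op lam p eps (u x0) phi x0).

End Defs.

(* Main.v *)
Require Import Defs.
From HB Require Import structures.
From mathcomp Require Import all_boot all_order all_algebra.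
From mathcomp Require Import all_classical all_reals all_analysis.
From mathcomp Require Import ring lra.
Import Order.TTheory GRing.Theory Num.Theory.
Import numFieldNormedType.Exports.
Local Open Scope classical_set_scope.
Local Open Scope ring_scope.

(** Since f is semiconcave and vanishes near the boundary, the zero extension U
of u is semiconcave on the whole space (doubling of variables with three
points).  At a maximum of u^eps(x) - U(y) - k |x - y|^2 with x interior, U is
touched from below at y, so its semiconcavity gives a paraboloid of fixed
opening touching u^eps from above at x; comparing the two equations bounds the
difference by C eps + o(1), which is at most eps^(1 - alpha/2) / lambda for
small eps.  When x lies on the boundary, U >= 0 and u^eps is bounded by a
barrier in an interior ball on which f = 0: with th the rescaled distance
(r^2 - |x - c|^2) / (2 r sqrt eps), the barrier is eps^(1 - alpha/2) times
G - th^alpha / alpha + th^2 / 8, the coefficients being chosen so that its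
minimum over th > 0 is 0; then G <= 2^alpha / alpha.  A small multiple of
- ln th makes it infinite on the sphere, which confines the comparison to
interior points. *)

(** The obstacle is that u^eps is a subsolution only inside the domain, so at boundary points no
    equation bounds it from above; its values there need a separate estimate, and that estimate
    produces the power of eps. Scaling dictates the rate: for a profile eps^b h(d / sqrt eps), with
    d the distance to the boundary, |Du|^p and eps Delta u have the same order exactly when b = p /
    (2 (p - 1)) = 1 - alpha / 2, and that order is eps^b. The term lambda u absorbs a residual of
    this size at the price eps^b / lambda, which is the first constant; the height of the profile at
    the boundary gives the second. In the interior, eps^b / lambda pays for the viscous term because
    eps = o(eps^b), and the second constant remains as a positive slack that pays for the modulus of
    continuity of f. The zero extension puts the limit problem on the whole space, so the second
    doubled variable never meets a boundary. *)

Set Implicit Arguments. Unset Strict Implicit. Unset Printing Implicit Defensive.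

(** * Euclidean inner product and its comparison with the max norm *)

Section Euclid.
Context {R : realType} {n : nat}.
Implicit Types (x y z : 'rV[R]_n) (t : R).

Definition dot x y : R := \sum_(i < n) x 0 i * y 0 i.
(** Distances are measured by their squares: these are polynomial, hence smooth at 0, and
    inequalities between them stay within reach of [lra]. *)
Definition sqn x : R := dot x x.

Lemma dotC x y : dot x y = dot y x.
Proof. by apply: eq_bigr => i _; rewrite mulrC. Qed.

Lemma dotDl x y z : dot (x + y) z = dot x z + dot y z.
Proof. by rewrite -big_split; apply: eq_bigr => i _; rewrite mxE mulrDl. Qed.

Lemma dotDr x y z : dot z (x + y) = dot z x + dot z y.
Proof. by rewrite dotC dotDl !(dotC z). Qed.

Lemma dotZl t x y : dot (t *: x) y = t * dot x y.
Proof. by rewrite mulr_sumr; apply: eq_bigr => i _; rewrite mxE mulrA. Qed.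

Lemma dotZr t x y : dot x (t *: y) = t * dot x y.
Proof. by rewrite dotC dotZl dotC. Qed.

Lemma dotNl x y : dot (- x) y = - dot x y.
Proof. by rewrite -scaleN1r dotZl mulN1r. Qed.

Lemma dotNr x y : dot x (- y) = - dot x y.
Proof. by rewrite dotC dotNl dotC. Qed.

Lemma dot0l x : dot 0 x = 0.
Proof. by rewrite -(scale0r x) dotZl mul0r. Qed.

Lemma dot0r x : dot x 0 = 0.
Proof. by rewrite dotC dot0l. Qed.

Lemma sqn_ge0 x : 0 <= sqn x.
Proof. by apply: sumr_ge0 => i _; rewrite -expr2 sqr_ge0. Qed.

Lemma sqn0 : sqn 0 = 0.
Proof. exact: dot0l. Qed.

Lemma sqnN x : sqn (- x) = sqn x.
Proof. by rewrite /sqn dotNl dotNr opprK. Qed.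

Lemma sqnZ t x : sqn (t *: x) = t ^+ 2 * sqn x.
Proof. by rewrite /sqn dotZl dotZr mulrA. Qed.

Lemma sqnD x y : sqn (x + y) = sqn x + 2 * dot x y + sqn y.
Proof. rewrite /sqn !dotDl !dotDr (dotC y x); ring. Qed.

Lemma sqnB x y : sqn (x - y) = sqn x - 2 * dot x y + sqn y.
Proof. by rewrite sqnD sqnN dotNr mulrN. Qed.

Lemma sqn_eq0 x : (sqn x == 0) = (x == 0).
Proof.
apply/eqP/eqP => [|->]; last exact: sqn0.
move=> /eqP; rewrite /sqn /dot psumr_eq0 => [|i _]; last by rewrite -expr2 sqr_ge0.
move=> /allP x0; apply/rowP => i; rewrite mxE.
by have := x0 i (mem_index_enum _); rewrite /= mulf_eq0 orbb => /eqP.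
Qed.

Lemma sqn_gt0 x : x != 0 -> 0 < sqn x.
Proof. by rewrite lt0r sqn_ge0 sqn_eq0 andbT. Qed.

Lemma enorm_sqrt x : enorm x = Num.sqrt (sqn x).
Proof. by congr Num.sqrt; apply: eq_bigr => i _; rewrite expr2. Qed.

Lemma enorm_sqn x : enorm x ^+ 2 = sqn x.
Proof. by rewrite enorm_sqrt sqr_sqrtr // sqn_ge0. Qed.

Lemma enorm_ge0 x : 0 <= enorm x.
Proof. by rewrite enorm_sqrt sqrtr_ge0. Qed.

Lemma enorm_ltE x t : 0 < t -> (enorm x < t) = (sqn x < t ^+ 2).
Proof.
by move=> t0; rewrite -enorm_sqn ltr_pXn2r ?nnegrE ?enorm_ge0 // ltW.
Qed.

Lemma enorm_powR x (p : R) : enorm x `^ p = sqn x `^ (p / 2).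
Proof.
rewrite -enorm_sqn -powR_mulrn ?enorm_ge0 // -powRrM; congr (_ `^ _).
by field.
Qed.

Lemma sqnD_le x y : sqn (x + y) <= 2 * sqn x + 2 * sqn y.
Proof.
have : 0 <= sqn (x - y) by exact: sqn_ge0.
rewrite sqnB sqnD; lra.
Qed.

Lemma coord_le_norm x i : `|x 0 i| <= `|x|.
Proof.
rewrite [leRHS]/Num.norm /= mx_normrE.
exact: (le_bigmax _ (fun ij : 'I_1 * 'I_n => `|x ij.1 ij.2|) (0, i)).
Qed.

Lemma sqn_le_norm x : sqn x <= n%:R * `|x| ^+ 2.
Proof.
rewrite /sqn /dot; apply: (@le_trans _ _ (\sum_(i < n) `|x| ^+ 2)); last first.
  by rewrite sumr_const card_ord mulr_natl.
apply: ler_sum => i _; rewrite -expr2 -real_normK ?num_real //.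
by rewrite ler_pXn2r ?nnegrE ?coord_le_norm.
Qed.

Lemma coord_le_sqn x i : x 0 i ^+ 2 <= sqn x.
Proof.
rewrite /sqn /dot (bigD1 i) //= -expr2 lerDl sumr_ge0 // => j _.
by rewrite -expr2 sqr_ge0.
Qed.

Lemma norm_le_sqn x : `|x| ^+ 2 <= sqn x.
Proof.
have -> : `|x| = mx_norm x by [].
have [->|/mx_norm_neq0[[j i] ->]] := eqVneq (mx_norm x) 0.
  by rewrite expr0n sqn_ge0.
by rewrite /= real_normK ?num_real // (ord1 j) coord_le_sqn.
Qed.

Lemma norm_lt_sqn x t : 0 < t -> sqn x < t ^+ 2 -> `|x| < t.
Proof.
move=> t0 xt; rewrite -(@ltr_pXn2r _ 2) ?nnegrE // ?(ltW t0) //.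
exact: le_lt_trans (norm_le_sqn x) xt.
Qed.

Lemma continuous_coord (i : 'I_n) : continuous (fun x => x 0 i : R).
Proof. exact: coord_continuous. Qed.

Lemma continuous_dot (T : topologicalType) (f g : T -> 'rV[R]_n) (a : T) :
  {for a, continuous f} -> {for a, continuous g} ->
  {for a, continuous (fun w => dot (f w) (g w))}.
Proof.
move=> cf cg.
have c (h : T -> 'rV[R]_n) (i : 'I_n) : {for a, continuous h} ->
    {for a, continuous (fun w => h w 0 i)}.
  by move=> ch; apply: (@continuous_comp _ _ _ h (fun x => x 0 i)) => //;
     exact: continuous_coord.
rewrite /dot; have -> : (fun w => \sum_(i < n) f w 0 i * g w 0 i) =
    \sum_(i < n) (fun w => f w 0 i * g w 0 i).
  by apply/funext => w; rewrite fct_sumE.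
apply: (big_ind (fun h : T -> R => {for a, continuous h})).
- exact: cst_continuous.
- by move=> h k ch ck; apply: continuousD.
- by move=> i _; apply: continuousM; exact: c.
Qed.

Lemma continuous_sqn (T : topologicalType) (f : T -> 'rV[R]_n) (a : T) :
  {for a, continuous f} -> {for a, continuous (fun w => sqn (f w))}.
Proof. by move=> cf; exact: continuous_dot. Qed.

Lemma nbhs_sqn (x : 'rV[R]_n) t : 0 < t -> \forall y \near x, sqn (y - x) < t.
Proof.
move=> t0.
have c : {for x, continuous (fun y => sqn (y - x))}.
  apply: continuous_sqn; apply: continuousB; [exact: id|exact: cst_continuous].
have : (fun y => sqn (y - x)) @ x --> 0.
  by rewrite -[X in _ --> X]sqn0 -(subrr x).
by move/cvgr_lt; apply.
Qed.

Lemma near_sqn_ball (x : 'rV[R]_n) (P : set 'rV[R]_n) : (\forall y \near x, P y) ->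
  exists2 r : R, 0 < r & forall y, sqn (y - x) < r ^+ 2 -> P y.
Proof.
move=> /nbhs_ballP[r /= r0 xP]; exists r => // y yx; apply: xP.
by rewrite -ball_normE /= -opprB normrN; exact: norm_lt_sqn.
Qed.

End Euclid.

(** * Polynomial test functions *)

Section TestFunctions.
Context {R : realType} {n : nat}.
Implicit Types (x z q : 'rV[R]_n) (k a b : R).

Lemma is_derive_coord x v (i : 'I_n) :
  is_derive x v (fun y : 'rV[R]_n => y 0 i : R) (v 0 i).
Proof.
have lim : (fun h : R => h^-1 *: (((fun y : 'rV[R]_n => y 0 i : R) \o shift x) (h *: v) - x 0 i))
    @ 0^' --> (v 0 i : R).
  apply: cvg_near_cst; near=> h => /=.
  rewrite !mxE addrK /GRing.scale /= mulKf //.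
  near: h; exact: nbhs_dnbhs_neq.
apply: DeriveDef; first by apply/cvg_ex; exists (v 0 i).
exact: cvg_lim lim.
Unshelve. all: by end_near. Qed.

Lemma is_derive_coordB z x v (i : 'I_n) :
  is_derive x v (fun y => (y - z) 0 i) (v 0 i).
Proof.
have -> : (fun y => (y - z) 0 i) =
    (fun y : 'rV[R]_n => y 0 i : R) + cst (- z 0 i).
  by apply/funext => y; rewrite !mxE.
have d := is_derive_coord x v i.
by have := is_deriveD d (is_derive_cst (- z 0 i : R) x v); rewrite addr0.
Qed.

Lemma is_derive_sqnB z x v :
  is_derive x v (fun y => sqn (y - z)) (2 * dot (x - z) v).
Proof.
have d i : is_derive x v ((fun y => (y - z) 0 i) * (fun y => (y - z) 0 i))
    (2 * ((x - z) 0 i * v 0 i)).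
  have e := is_derive_coordB z x v i.
  by apply: is_derive_eq; rewrite /GRing.scale /=; ring.
have := is_derive_sum d; rewrite -mulr_sumr => ds.
have -> : (fun y => sqn (y - z)) =
  \sum_(i < n) ((fun y => (y - z) 0 i) * (fun y => (y - z) 0 i)).
  by apply/funext => y; rewrite fct_sumE.
exact: ds.
Qed.

Lemma is_derive_dotB q z x v :
  is_derive x v (fun y => dot q (y - z)) (dot q v).
Proof.
have d i : is_derive x v (q 0 i *: (fun y => (y - z) 0 i))
    (q 0 i * v 0 i).
  have e := is_derive_coordB z x v i.
  by apply: is_derive_eq.
have ds := is_derive_sum d.
have -> : (fun y => dot q (y - z)) =
  \sum_(i < n) (q 0 i *: (fun y => (y - z) 0 i)).
  by apply/funext => y; rewrite fct_sumE.
exact: ds.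
Qed.

(** Test functions must be smooth on the whole space, whereas the barrier lives only inside a ball.
    All tests therefore use this family: with b = 0 for paraboloids at the touching point, with q =
    0 for the second-order expansion of a radial function in the variable |x - z|^2. *)
Definition quartic z q k a b x : R :=
  k + dot q (x - z) + a * sqn (x - z) + b * sqn (x - z) ^+ 2.

Lemma is_derive_quartic z q k a b x v : is_derive x v (quartic z q k a b)
  (dot q v + (2 * a + 4 * b * sqn (x - z)) * dot (x - z) v).
Proof.
have -> : quartic z q k a b = cst k + (fun y => dot q (y - z)) +
    a *: (fun y => sqn (y - z)) +
    b *: ((fun y => sqn (y - z)) * (fun y => sqn (y - z))).
  by apply/funext => y; rewrite /quartic expr2.
have d1 := is_derive_dotB q z x v.
have d2 := is_derive_sqnB z x v.
by apply: is_derive_eq; rewrite /GRing.scale /=; ring.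
Qed.

Lemma evecE (i j : 'I_n) : evec R i 0 j = (i == j)%:R.
Proof. by rewrite mxE eqxx /= eq_sym. Qed.

Lemma dot_evec x (i : 'I_n) : dot x (evec R i) = x 0 i.
Proof.
rewrite /dot (bigD1 i) //= evecE eqxx mulr1 big1 ?addr0 // => j ji.
by rewrite evecE eq_sym (negbTE ji) mulr0.
Qed.

Lemma partial_quartic z q k a b (i : 'I_n) : partial (quartic z q k a b) i =
  (fun x => q 0 i + (2 * a + 4 * b * sqn (x - z)) * (x - z) 0 i).
Proof.
apply/funext => x; rewrite /partial.
by have [_ ->] := is_derive_quartic z q k a b x (evec R i); rewrite !dot_evec.
Qed.

Lemma is_derive_partial_quartic z q k a b (i j : 'I_n) x :
  is_derive x (evec R j) (partial (quartic z q k a b) i)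
   (8 * b * (x - z) 0 j * (x - z) 0 i
    + (2 * a + 4 * b * sqn (x - z)) * (j == i)%:R).
Proof.
rewrite partial_quartic.
have -> : (fun y => q 0 i + (2 * a + 4 * b * sqn (y - z)) * (y - z) 0 i) =
    cst (q 0 i) + ((cst (2 * a) + (4 * b) *: (fun y => sqn (y - z))) *
      (fun y => (y - z) 0 i)).
  by apply/funext.
have d1 := is_derive_coordB z x (evec R j) i.
have d2 := is_derive_sqnB z x (evec R j).
apply: is_derive_eq; rewrite /GRing.scale /= dot_evec evecE /=.
rewrite (_ : (cst (2 * a) + _) x = 2 * a + 4 * b * sqn (x - z)) //; ring.
Qed.

Lemma test_fun_quartic eps z q k a b : test_fun eps (quartic z q k a b).
Proof.
have cB x : {for x, continuous (fun y : 'rV[R]_n => y - z)}.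
  by apply: continuousB; [exact: id|exact: cst_continuous].
have cS x : {for x, continuous (fun y : 'rV[R]_n => sqn (y - z))}.
  exact: continuous_sqn.
have cC i x : {for x, continuous (fun y : 'rV[R]_n => (y - z) 0 i : R)}.
  apply: (@continuous_comp _ _ _ (fun y : 'rV[R]_n => y - z) (fun y : 'rV[R]_n => y 0 i : R)) => //.
  exact: continuous_coord.
have c1 : C1_on setT (quartic z q k a b).
  move=> i x _; split; first by have [] := is_derive_quartic z q k a b x (evec R i).
  rewrite partial_quartic; apply: continuousD; first exact: cst_continuous.
  apply: continuousM => //; apply: continuousD; first exact: cst_continuous.
  by apply: continuousM => //; exact: cst_continuous.
rewrite /test_fun; case: ifP => // _; split=> // i j x _; split.
  by have [] := is_derive_partial_quartic z q k a b i j x.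
have -> : partial (partial (quartic z q k a b) i) j = (fun x =>
    8 * b * (x - z) 0 j * (x - z) 0 i
    + (2 * a + 4 * b * sqn (x - z)) * (j == i)%:R).
  apply/funext => y; rewrite {1}/partial.
  by have [_ ->] := is_derive_partial_quartic z q k a b i j y.
apply: continuousD.
  by apply: continuousM => //; apply: continuousM => //; exact: cst_continuous.
apply: continuousM; last exact: cst_continuous.
apply: continuousD; first exact: cst_continuous.
by apply: continuousM => //; exact: cst_continuous.
Qed.

Lemma grad_quartic z q k a b x : grad (quartic z q k a b) x =
  q + (2 * a + 4 * b * sqn (x - z)) *: (x - z).
Proof. by apply/rowP => i; rewrite !mxE partial_quartic !mxE. Qed.

Lemma lap_quartic z q k a b x : lap (quartic z q k a b) x =
  8 * b * sqn (x - z) + (2 * a + 4 * b * sqn (x - z)) * n%:R.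
Proof.
rewrite /lap (eq_bigr (fun i => 8 * b * ((x - z) 0 i * (x - z) 0 i)
    + (2 * a + 4 * b * sqn (x - z)))).
  by rewrite big_split /= -mulr_sumr sumr_const card_ord mulr_natr.
move=> i _; rewrite {1}/partial.
have [_ ->] := is_derive_partial_quartic z q k a b i i x.
by rewrite eqxx mulr1 mulrA.
Qed.

(** The paraboloid is centred at the touching point, so only its slope q and its Laplacian 2 a n
    survive there. Both eps = 0 and eps > 0 are covered. *)
Lemma SC_sub_quadratic (O : set 'rV[R]_n) (lam p eps : R) (f u : 'rV[R]_n -> R) x q a :
  SC_solution O lam p eps f u -> O x ->
  (\forall h \near (0 : 'rV[R]_n), O (x + h) -> u (x + h) <= u x + dot q h + a * sqn h) ->
  lam * u x + sqn q `^ (p / 2) - 2 * eps * a * n%:R <= f x.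
Proof.
move=> sol Ox hu; have [_ [sub _]] := sol.
have [r r0 hr] := near_sqn_ball hu.
have := sub (quartic x q 0 a 0) x (test_fun_quartic _ _ _ _ _ _) Ox.
rewrite /SC_op grad_quartic lap_quartic subrr scaler0 addr0 sqn0 enorm_powR.
rewrite !mulr0 add0r addr0 => H.
have -> : 2 * eps * a * n%:R = eps * (2 * a * n%:R) by ring.
apply: H; exists r; split => // y Oy; rewrite enorm_ltE // => yx.
have := hr (y - x); rewrite subr0 subrKC => /(_ yx Oy).
rewrite /quartic subrr sqn0 dot0r; lra.
Qed.

Lemma SC_super_quadratic (O : set 'rV[R]_n) (lam p eps : R) (f u : 'rV[R]_n -> R) x q a :
  SC_solution O lam p eps f u -> closure O x ->
  (\forall h \near (0 : 'rV[R]_n), closure O (x + h) ->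
     u x + dot q h + a * sqn h <= u (x + h)) ->
  f x <= lam * u x + sqn q `^ (p / 2) - 2 * eps * a * n%:R.
Proof.
move=> sol Ox hu; have [_ [_ sup]] := sol.
have [r r0 hr] := near_sqn_ball hu.
have := sup (quartic x q 0 a 0) x (test_fun_quartic _ _ _ _ _ _) Ox.
rewrite /SC_op grad_quartic lap_quartic subrr scaler0 addr0 sqn0 enorm_powR.
rewrite !mulr0 add0r addr0 => H.
have -> : 2 * eps * a * n%:R = eps * (2 * a * n%:R) by ring.
apply: H; exists r; split => // y Oy; rewrite enorm_ltE // => yx.
have := hr (y - x); rewrite subr0 subrKC => /(_ yx Oy).
rewrite /quartic subrr sqn0 dot0r; lra.
Qed.

End TestFunctions.

(** * Convexity inequalities for real powers *)

Section PowerInequalities.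
Context {R : realType}.
Implicit Types (p s t : R).

(** Young's inequality for the product of t and 1 with exponents p and p / (p - 1), multiplied by
    p. *)
Lemma powR_bernoulli p t : 1 < p -> 0 <= t -> 1 + p * (t - 1) <= t `^ p.
Proof.
move=> p1 t0; have p0 : 0 < p by lra.
have pp : p - 1 != 0 by apply/eqP; lra.
have pn : p != 0 by rewrite gt_eqF.
have q0 : 0 < p / (p - 1) by apply: divr_gt0; lra.
have c : p^-1 + (p / (p - 1))^-1 = 1 by field; rewrite pp pn.
have := @conjugate_powR R t 1 p (p / (p - 1)) t0 ler01 p0 q0 c.
rewrite powR1 mulr1 -(ler_pM2r p0) mulrDl divfK //.
have -> : 1 / (p / (p - 1)) * p = p - 1 by field; rewrite pp pn.
by move=> H; nra.
Qed.

Lemma powR_tangent p s t : 1 < p -> 0 < t -> 0 <= s ->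
  t `^ p + p * t `^ (p - 1) * (s - t) <= s `^ p.
Proof.
move=> p1 t0 s0.
have tp : 0 < t `^ p by exact: powR_gt0.
have -> : s `^ p = t `^ p * (s / t) `^ p.
  by rewrite -powRM ?divr_ge0 ?(ltW t0) // mulrCA mulfV ?gt_eqF // mulr1.
rewrite -(mulr_powRB1 (ltW t0)) ?(lt_trans ltr01) //.
have -> : t * t `^ (p - 1) + p * t `^ (p - 1) * (s - t) =
    t * t `^ (p - 1) * (1 + p * (s / t - 1)) by field; rewrite gt_eqF.
rewrite (mulr_powRB1 (ltW t0)) ?(lt_trans ltr01) // ler_pM2l //.
by apply: powR_bernoulli; rewrite // divr_ge0 // ltW.
Qed.

(** Add the two tangent inequalities at the midpoint: the linear terms cancel. A zero midpoint is
    separate because the tangent needs a positive base. *)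
Lemma powR_midpoint p s t : 1 < p -> 0 <= s -> 0 <= t ->
  2 * ((s + t) / 2) `^ p <= s `^ p + t `^ p.
Proof.
move=> p1 s0 t0; have [m0|m0] := eqVneq ((s + t) / 2) 0.
  rewrite m0 powR0 ?mulr0 ?addr_ge0 ?powR_ge0 // gt_eqF //; lra.
have m1 : 0 < (s + t) / 2 by rewrite lt0r m0 /=; lra.
have := powR_tangent p1 m1 s0; have := powR_tangent p1 m1 t0; nra.
Qed.

End PowerInequalities.

(** * Maxima and uniform continuity from compactness *)

Section Compactness.
Context {R : realType} {n : nat}.
Notation V := 'rV[R]_n.

(** By the parallelogram law the mean of |e + q|^2 and |e - q|^2 is at least |e|^2; then apply
    convexity of the power p / 2. This compares the gradient terms in the three-point doubling. *)
Lemma powR_parallelogram (p : R) (e q : V) : 2 < p ->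
  2 * sqn e `^ (p / 2) <= sqn (e + q) `^ (p / 2) + sqn (e - q) `^ (p / 2).
Proof.
move=> p2; have p1 : 1 < p / 2 by lra.
apply: le_trans (powR_midpoint p1 (sqn_ge0 _) (sqn_ge0 _)).
rewrite ler_pM2l //; apply: ge0_ler_powR; rewrite ?nnegrE ?sqn_ge0 //; first lra.
- by rewrite divr_ge0 // addr_ge0 ?sqn_ge0.
- by rewrite sqnB sqnD; have := sqn_ge0 q; lra.
Qed.

Lemma compact_sqn_ball (c : V) (r : R) : compact [set x | sqn (x - c) <= r].
Proof.
apply: bounded_closed_compact; last first.
  apply: (@closed_comp _ _ (fun x : V => sqn (x - c)) [set t | t <= r]).
    move=> x _; apply: (@continuous_sqn _ _ _ (fun x : V => x - c)).
    by apply: continuousB; [exact: id|exact: cst_continuous].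
  exact: closed_le.
exists (`|c| + `|r| + 1); split; first by rewrite num_real.
move=> M Mr x /= xr; apply: le_trans (ltW Mr).
rewrite -(subrK c x); apply: le_trans (ler_normD _ _) _.
have xc : `|x - c| ^+ 2 <= `|r|.
  exact: le_trans (norm_le_sqn _) (le_trans xr (ler_norm _)).
have := normr_ge0 (x - c); have := normr_ge0 r; nra.
Qed.

Lemma compact_max (T : topologicalType) (F : T -> R) (K : set T) :
  K !=set0 -> compact K -> {within K, continuous F} ->
  exists2 c, K c & forall w, K w -> F w <= F c.
Proof.
move=> K0 cK cF; have [c cin hc] := compact_EVT_max K0 cK cF.
by exists c; [rewrite inE in cin|move=> w Kw; apply: hc; rewrite inE].
Qed.

Lemma coercive_max (T : topologicalType) (F : T -> R) (K : set T) (w0 : T) :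
  continuous F -> compact K -> 0 < F w0 -> (forall w, ~ K w -> F w <= 0) ->
  exists c, forall w, F w <= F c.
Proof.
move=> cF cK F0 Fout.
have Kw0 : K w0 by apply: contrapT => /Fout; rewrite leNgt F0.
have [c _ hc] := compact_max (ex_intro _ w0 Kw0) cK (continuous_subspaceT cF).
exists c => w; have [/hc//|/Fout Fw] := pselect (K w).
exact: le_trans Fw (le_trans (ltW F0) (hc _ Kw0)).
Qed.

Lemma compact_support_bounded (g : V -> R) (rho : R) : continuous g ->
  (forall x, rho <= sqn x -> g x = 0) -> exists2 M, 0 < M & forall x, `|g x| <= M.
Proof.
move=> cg g0.
have cn : continuous (fun x => `|g x|).
  by move=> x; apply: (@continuous_comp _ _ _ g Num.norm); [exact: cg|exact: norm_continuous].
have [gz|] := pselect (forall x, g x = 0).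
  by exists 1 => // x; rewrite gz normr0.
move=> /existsNP[x /eqP x0].
have [||c hc] := @coercive_max _ _ _ x cn (@compact_sqn_ball 0 rho).
- by rewrite normr_gt0.
- move=> w /= /negP; rewrite subr0 -ltNge => /ltW /g0 ->; by rewrite normr0.
- exists `|g c| => //; apply: lt_le_trans (hc x); by rewrite normr_gt0.
Qed.

Lemma compact_support_ucont (g : V -> R) (rho : R) : continuous g ->
  (forall x, rho <= sqn x -> g x = 0) ->
  forall e, 0 < e -> exists2 d, 0 < d &
    forall x y, sqn (x - y) < d -> `|g x - g y| < e.
Proof.
move=> cg g0 e e0; have e2 : 0 < e / 2 by lra.
have : \forall d \near 0^'+, [set x | sqn (x - 0) <= rho] `<=`
    [set x | forall y, sqn (x - y) < d -> `|g x - g y| < e].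
  have /compact_near_coveringP := @compact_sqn_ball 0 rho.
  apply => x0 _.
  have /near_sqn_ball[r r0 hr] : \forall y \near x0, `|g x0 - g y| < e / 2.
    by have /cvgrPdist_lt := cg x0; apply.
  have r2 : 0 < r ^+ 2 by exact: exprn_gt0.
  (* The quarters compensate the factor 2 in [sqnD_le]: two squared distances below r^2 / 4 add up
     to one below r^2. *)
  exists ([set x | sqn (x - x0) < r ^+ 2 / 4], [set d | d < r ^+ 2 / 4]) => /=.
    split; first by apply: nbhs_sqn; lra.
    by apply: nbhs_right_lt; lra.
  move=> [x d] /= [xx0 dr] y xy.
  have yx0 : sqn (y - x0) < r ^+ 2.
    have -> : y - x0 = (x - x0) - (x - y) by rewrite opprB [RHS]addrC addrA subrK.
    apply: le_lt_trans (sqnD_le _ _) _; rewrite sqnN; lra.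
  have xx1 : sqn (x - x0) < r ^+ 2 by lra.
  have h1 := hr _ xx1; have h2 := hr _ yx0.
  rewrite (_ : g x - g y = (g x0 - g y) - (g x0 - g x)); last by ring.
  apply: le_lt_trans (ler_normB _ _) _; lra.
move=> near_d.
have [d [d0 hd]] := filter_ex (filterI (nbhs_right_gt (0 : R)) near_d).
exists d => //.
have key x y : sqn x <= rho -> sqn (x - y) < d -> `|g x - g y| < e.
  by move=> xr; apply: hd; rewrite /= subr0.
move=> x y xy; have [xr|xr] := leP (sqn x) rho; first exact: key.
have [yr|yr] := leP (sqn y) rho.
  by rewrite distrC key // -opprB sqnN.
by rewrite !g0 ?ltW // subrr normr0.
Qed.

End Compactness.

(** * Semiconcavity of the limit solution *)

Section Semiconcavity.
Context {R : realType} {n : nat}.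
Notation V := 'rV[R]_n.
Implicit Types (x y h a q : V) (g f : V -> R).

Definition midpoint_semiconcave (K : R) g :=
  forall x h, g (x + h) + g (x - h) - 2 * g x <= K * sqn h.

(** The upper opening C / 2 does not depend on k, which is large in the application. The midpoint
    inequality at y gives the opening C + k; applied at y + h / 2 it halves the excess over C / 2,
    and iteration removes the excess without any differentiability of g. *)
Lemma semiconcave_touch (C k : R) g y a : midpoint_semiconcave C g ->
  (forall h, g y + dot a h - k * sqn h <= g (y + h)) ->
  forall h, g (y + h) <= g y + dot a h + C / 2 * sqn h.
Proof.
move=> gC gk h.
have step j : forall h, g (y + h) <= g y + dot a h + (C / 2 + (C / 2 + k) / 2 ^+ j) * sqn h.
  elim: j => [|j IH] {}h.
    have := gC y h; have := gk (- h); rewrite expr0 divr1 dotNr sqnN; lra.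
  have := IH (2^-1 *: h).
  have yh : y + 2^-1 *: h + 2^-1 *: h = y + h.
    have h1 : (2^-1 + 2^-1 : R) = 1 by lra.
    by rewrite -addrA -scalerDl h1 scale1r.
  have := gC (y + 2^-1 *: h) (2^-1 *: h).
  rewrite yh addrK sqnZ dotZr (exprS 2 j) invfM expr2; lra.
rewrite leNgt; apply/negP => X0; set X := g (y + h) - (g y + dot a h + C / 2 * sqn h).
have {}X0 : 0 < X by rewrite /X; lra.
have [j Xj] : exists j, (C / 2 + k) * sqn h / X < 2 ^+ j.
  by eexists; exact: upper_nthrootP (leqnn _).
rewrite ltr_pdivrMr // in Xj.
have := step j h; suff : (C / 2 + k) / 2 ^+ j * sqn h < X by rewrite /X; lra.
by rewrite mulrAC ltr_pdivrMr ?exprn_gt0 // [ltRHS]mulrC.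
Qed.

(** If the second difference of g exceeded its bound by D > 0, the penalised functional [F] would
    have a maximum (x, z, y) of value at least D. Testing g from above at x and z and from below at
    y, and using convexity of |.|^p, gives lam (g x + g z - 2 g y) <= f x + f z - 2 f y.
    Semiconcavity of f then contradicts the excess. *)
Lemma midpoint_semiconcave_transfer (lam p K rho : R) (g f : V -> R) :
  0 < lam -> 2 < p -> 0 < K ->
  continuous g -> continuous f -> (forall x, 0 <= g x) ->
  (forall x, rho <= sqn x -> g x = 0) -> (forall x, rho <= sqn x -> f x = 0) ->
  (forall x q k, (forall h, g (x + h) <= g x + dot q h + k * sqn h) ->
     lam * g x + sqn q `^ (p / 2) <= f x) ->
  (forall x q k, (forall h, g x + dot q h - k * sqn h <= g (x + h)) ->
     f x <= lam * g x + sqn q `^ (p / 2)) ->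
  midpoint_semiconcave K f -> midpoint_semiconcave (K / lam) g.
Proof.
move=> lam0 p2 K0 cg cf g0 gS fS sub sup fK x0 h0; set C := K / lam.
have C0 : 0 < C by exact: divr_gt0.
have lC : lam * C = K by rewrite /C mulrCA mulfV ?gt_eqF // mulr1.
rewrite leNgt; apply/negP => D0'.
set D := g (x0 + h0) + g (x0 - h0) - 2 * g x0 - C * sqn h0.
have D0 : 0 < D by rewrite /D; lra.
have [M M0 gM] := compact_support_bounded cg gS.
have gM' x : g x <= M by apply: le_trans (gM x); exact: ler_norm.
(* Replacing f at the midpoint of x and z by f y happens twice, so it costs lam D / 2, half of the
   excess lam D. *)
have w0 : 0 < lam * D / 4 by rewrite divr_gt0 // mulr_gt0.
have [d d0 fd] := compact_support_ucont cf fS w0.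
(* Where [F] is positive, |x + z - 2 y|^2 <= 2 M del = 2 d, so y is within squared distance d / 2 of
   the midpoint. The coefficient C / 4 in [F] appears because the increment is half of x - z. *)
pose del := d / M; have del0 : 0 < del by exact: divr_gt0.
pose F (w : V * V * V) : R := g w.1.1 + g w.1.2 - 2 * g w.2
  - C / 4 * sqn (w.1.1 - w.1.2) - del^-1 * sqn (w.1.1 + w.1.2 - 2 *: w.2).
have Fpos x z y : 0 < F (x, z, y) -> [/\ sqn (x - z) <= 8 * M / C,
    sqn (x + z - 2 *: y) <= del * (2 * M) & sqn x < rho \/ sqn z < rho].
  rewrite /F /= => Fp.
  have n1 := sqn_ge0 (x - z); have n2 := sqn_ge0 (x + z - 2 *: y).
  have Cn : 0 <= C / 4 * sqn (x - z) by rewrite mulr_ge0 //; lra.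
  have dn : 0 <= del^-1 * sqn (x + z - 2 *: y) by rewrite mulr_ge0 // invr_ge0 ltW.
  have gx := gM' x; have gz := gM' z; have gy := g0 y; split.
  - rewrite ler_pdivlMr //; nra.
  - rewrite -ler_pdivrMl //; lra.
  - have [xr|xr] := ltP (sqn x) rho; first by left.
    have [zr|zr] := ltP (sqn z) rho; first by right.
    by move: Fp; rewrite (gS x) // (gS z) //; lra.
(* One of x, z lies in the ball carrying g, the other is close to it, and y is close to their
   midpoint; [sqnD_le] turns this into these radii, so [F] is positive only on a compact set. *)
pose B1 := 2 * rho + 16 * M / C; pose B2 := 2 * B1 + rho + d.
have cF : continuous F.
  have cG (k : V * V * V -> V) w : {for w, continuous k} -> {for w, continuous (g \o k)}.
    by move=> ck; apply: continuous_comp => //; exact: cg.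
  move=> w.
  have c1 : {for w, continuous (fun w : V * V * V => w.1.1)}.
    by apply: (@continuous_comp _ _ _ fst fst); [exact: cvg_fst|exact: cvg_fst].
  have c2 : {for w, continuous (fun w : V * V * V => w.1.2)}.
    by apply: (@continuous_comp _ _ _ fst snd); [exact: cvg_fst|exact: cvg_snd].
  have c3 : {for w, continuous (fun w : V * V * V => w.2)} by exact: cvg_snd.
  have cc (t : R) : {for w, continuous (fun _ : V * V * V => t)} by exact: cst_continuous.
  have cs1 : {for w, continuous (fun w : V * V * V => sqn (w.1.1 - w.1.2))}.
    by apply: (@continuous_sqn _ _ _ (fun w : V * V * V => w.1.1 - w.1.2)); exact: cvgB.
  have cs2 : {for w, continuous (fun w : V * V * V => sqn (w.1.1 + w.1.2 - 2 *: w.2))}.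
    apply: (@continuous_sqn _ _ _ (fun w : V * V * V => w.1.1 + w.1.2 - 2 *: w.2)).
    by apply: cvgB; [exact: cvgD|exact: continuousZl_tmp].
  rewrite /F; apply: cvgB; first apply: cvgB; first apply: cvgB; first apply: cvgD.
  - exact: cG c1.
  - exact: cG c2.
  - by apply: cvgM; [exact: cc|exact: cG c3].
  - by apply: cvgM; [exact: cc|exact: cs1].
  - by apply: cvgM; [exact: cc|exact: cs2].
have Fw0 : 0 < F (x0 + h0, x0 - h0, x0).
  rewrite /F /=; have -> : x0 + h0 - (x0 - h0) = 2 *: h0.
    by rewrite opprB [LHS]addrC addrA subrK -mulr2n scaler_nat.
  have -> : x0 + h0 + (x0 - h0) - 2 *: x0 = 0.
    by rewrite addrACA subrr addr0 -mulr2n scaler_nat subrr.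
  rewrite sqn0 sqnZ; move: D0; rewrite /D; lra.
pose K3 := [set x : V | sqn (x - 0) <= B2] `*` [set x : V | sqn (x - 0) <= B2] `*` [set x : V | sqn (x - 0) <= B2].
have cK3 : compact K3.
  apply: compact_setX; first apply: compact_setX; exact: compact_sqn_ball.
have Fout w : ~ K3 w -> F w <= 0.
  case: w => [[x z] y] nK; rewrite leNgt; apply/negP => /Fpos[xz xzy xorz].
  apply: nK; rewrite /K3 /= !subr0.
  have MC : 0 <= M / C by rewrite divr_ge0 // ltW.
  have rho0 : 0 < rho by case: xorz; apply: le_lt_trans; exact: sqn_ge0.
  have [xB zB] : sqn x <= B1 /\ sqn z <= B1.
    have zx : z = x - (x - z) by rewrite subKr.
    have xx : x = (x - z) + z by rewrite subrK.
    case: xorz => xr; split.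
    + by rewrite /B1; lra.
    + rewrite zx; apply: le_trans (sqnD_le _ _) _; rewrite sqnN /B1; lra.
    + rewrite xx; apply: le_trans (sqnD_le _ _) _; rewrite /B1; lra.
    + by rewrite /B1; lra.
  have dM : del * (2 * M) = 2 * d by rewrite /del mulrCA divfK ?gt_eqF.
  have yB : sqn y <= B2.
    have y2 : 2 *: y = (x + z) - (x + z - 2 *: y) by rewrite subKr.
    have := sqnD_le (x + z) (- (x + z - 2 *: y)); rewrite -y2 sqnN sqnZ.
    by have := sqnD_le x z; rewrite /B2; lra.
  have B12 : B1 <= B2 by rewrite /B2 /B1; lra.
  by split; [split|]; rewrite ?(le_trans xB) ?(le_trans zB).
have [[[x z] y] hmax] := coercive_max cF cK3 Fw0 Fout.
have FD : D <= F (x, z, y).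
  apply: le_trans (hmax (x0 + h0, x0 - h0, x0)); rewrite /F /=.
  have -> : x0 + h0 - (x0 - h0) = 2 *: h0.
    by rewrite opprB [LHS]addrC addrA subrK -mulr2n scaler_nat.
  have -> : x0 + h0 + (x0 - h0) - 2 *: x0 = 0.
    by rewrite addrACA subrr addr0 -mulr2n scaler_nat subrr.
  rewrite sqn0 sqnZ /D; lra.
have [xz xzy _] := Fpos _ _ _ (lt_le_trans Fw0 (hmax _)).
(* The gradients of the two penalties: the test slopes are e + q at x, e - q at z and e at y. *)
pose q := (C / 2) *: (x - z); pose e := (2 / del) *: (x + z - 2 *: y).
pose k := C / 4 + del^-1.
have e1 : lam * g x + sqn (e + q) `^ (p / 2) <= f x.
  apply: (sub _ _ k) => h; have := hmax (x + h, z, y); rewrite /F /= => H.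
  have E1 : x + h - z = (x - z) + h by rewrite [LHS]addrAC.
  have E2 : x + h + z - 2 *: y = (x + z - 2 *: y) + h by rewrite (addrAC x h) [LHS]addrAC.
  rewrite E1 E2 !sqnD in H; rewrite /e /q /k dotDl !dotZl; lra.
have e2 : lam * g z + sqn (e - q) `^ (p / 2) <= f z.
  apply: (sub _ _ k) => h; have := hmax (x, z + h, y); rewrite /F /= => H.
  have E1 : x - (z + h) = (x - z) - h by rewrite opprD addrA.
  have E2 : x + (z + h) - 2 *: y = (x + z - 2 *: y) + h by rewrite addrA [LHS]addrAC.
  rewrite E1 E2 sqnB (sqnD (x + z - 2 *: y)) in H.
  rewrite /e /q /k dotDl dotNl !dotZl; lra.
have e3 : f y <= lam * g y + sqn e `^ (p / 2).
  apply: (sup _ _ (2 / del)) => h; have := hmax (x, z, y + h); rewrite /F /= => H.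
  have E1 : x + z - 2 *: (y + h) = (x + z - 2 *: y) - 2 *: h.
    by rewrite scalerDr opprD addrA.
  rewrite E1 (sqnB _ (2 *: h)) sqnZ dotZr in H; rewrite /e dotZl; lra.
have e4 := powR_parallelogram e q p2.
have fxz := fK (2^-1 *: (x + z)) (2^-1 *: (x - z)).
have half (v : V) : 2^-1 *: (v + v) = v.
  have h1 : (2^-1 + 2^-1 : R) = 1 by lra.
  by rewrite scalerDr -scalerDl h1 scale1r.
have mx : 2^-1 *: (x + z) + 2^-1 *: (x - z) = x.
  by rewrite -scalerDr addrACA subrr addr0 half.
have mz : 2^-1 *: (x + z) - 2^-1 *: (x - z) = z.
  by rewrite -scalerBr opprB [x + z]addrC addrACA subrr addr0 half.
rewrite mx mz sqnZ in fxz.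
have fy : `|f (2^-1 *: (x + z)) - f y| < lam * D / 4.
  apply: fd; have -> : 2^-1 *: (x + z) - y = 2^-1 *: (x + z - 2 *: y).
    by rewrite scalerBr scalerA mulVf // scale1r.
  rewrite sqnZ; move: xzy; rewrite /del mulrCA divfK ?gt_eqF // expr2; lra.
have {}fy := le_lt_trans (ler_norm _) fy.
have n1 : 0 <= del^-1 * sqn (x + z - 2 *: y) by rewrite mulr_ge0 ?sqn_ge0 // invr_ge0 ltW.
have FD' : lam * D <= lam * (g x + g z - 2 * g y) - K / 4 * sqn (x - z).
  have -> : K / 4 * sqn (x - z) = lam * (C / 4 * sqn (x - z)) by rewrite -lC; ring.
  rewrite -mulrBr ler_pM2l //; move: FD; rewrite /F /=; lra.
rewrite expr2 in fxz; have lD : 0 < lam * D by exact: mulr_gt0.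
lra.
Qed.

End Semiconcavity.

(** * The one-dimensional barrier profile *)

Section Barrier.
Context {R : realType}.
Implicit Types (p eta th : R).

(** The strict inequality d2 < K gives df t - df x the sign of an affine comparison on each side of
    x, and the mean value theorem integrates it. The barrier can thus be replaced by a quadratic at
    a touching point. *)
Lemma second_order_touch (f df : R -> R) (x d2 K : R) :
  (\forall y \near x, is_derive (y : R) (1 : R) f (df y)) -> is_derive x (1 : R) df d2 -> d2 < K ->
  \forall y \near x, f y <= f x + df x * (y - x) + K / 2 * (y - x) ^+ 2.
Proof.
move=> hf [ddf Ddf] d2K.
have : h^-1 *: ((df \o shift x) (h *: (1 : R)) - df x) @[h --> 0^'] --> d2.
  by rewrite -Ddf; exact: ddf.
move=> /cvgr_lt/(_ _ d2K) /nbhs_ballP[r1 /= r10 h1].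
move: hf => /nbhs_ballP[r2 /= r20 h2].
apply/nbhs_ballP; exists (Num.min r1 r2); first by rewrite /= lt_min r10 r20.
move=> y; rewrite /ball /= lt_min => /andP[y1 y2].
have quot t : `|x - t| < r1 -> t != x -> (t - x)^-1 * (df t - df x) < K.
  move=> tr tx; have := h1 (t - x); rewrite /ball /= sub0r normrN distrC.
  by move=> /(_ tr); rewrite subr_eq0 => /(_ tx); rewrite [_ *: (1 : R)]mulr1 subrK.
pose g t := f x + df x * (t - x) + K / 2 * (t - x) ^+ 2 - f t.
have dg t : `|x - t| < r2 -> is_derive t (1 : R) g (df x + K * (t - x) - df t).
  move=> tr; have d := h2 _ tr.
  by rewrite /g; apply: is_derive_eq; rewrite /GRing.scale /=; field.
have gx : g x = 0 by rewrite /g subrr; ring.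
suff : 0 <= g y by rewrite /g; lra.
have cg a b : (forall t, a <= t <= b -> `|x - t| < r2) -> {within `[a, b], continuous g}.
  move=> ab; apply: derivable_within_continuous => z; rewrite in_itv /= => abz.
  by have [] := dg _ (ab _ abz).
have [xy|yx|<-] := ltgtP x y; last by rewrite gx.
- have ab t : x <= t <= y -> `|x - t| < Num.min r1 r2.
    move=> /andP[xt ty]; apply: le_lt_trans (_ : `|x - y| < _); last by rewrite lt_min y1.
    by rewrite !ler0_norm; lra.
  have ab2 t (h : x <= t <= y) : `|x - t| < r2.
    by apply: lt_le_trans (ab _ h) _; rewrite ge_min lexx orbT.
  have [|c cxy] := MVT xy _ (cg _ _ ab2) (df := fun t => df x + K * (t - x) - df t).
    by move=> t; rewrite in_itv /= => /andP[xt ty]; apply/dg/ab2; lra.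
  rewrite gx subr0 => ->; move: cxy; rewrite in_itv /= => /andP[xc cy].
  apply: mulr_ge0; last lra.
  have := quot c; rewrite gt_eqF // => H.
  have {}H : (c - x)^-1 * (df c - df x) < K.
    by apply: H => //; apply: lt_le_trans (ab c _) _; [lra|rewrite ge_min lexx].
  rewrite mulrC ltr_pdivrMr in H; lra.
- have ab t : y <= t <= x -> `|x - t| < Num.min r1 r2.
    move=> /andP[xt ty]; apply: le_lt_trans (_ : `|x - y| < _); last by rewrite lt_min y1.
    by rewrite !ger0_norm; lra.
  have ab2 t (h : y <= t <= x) : `|x - t| < r2.
    by apply: lt_le_trans (ab _ h) _; rewrite ge_min lexx orbT.
  have [|c cxy] := MVT yx _ (cg _ _ ab2) (df := fun t => df x + K * (t - x) - df t).
    by move=> t; rewrite in_itv /= => /andP[xt ty]; apply/dg/ab2; lra.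
  rewrite gx sub0r => E; move: cxy; rewrite in_itv /= => /andP[yc cx].
  have := quot c; rewrite lt_eqF // => H.
  have {}H : (c - x)^-1 * (df c - df x) < K.
    by apply: H => //; apply: lt_le_trans (ab c _) _; [lra|rewrite ge_min lexx].
  have : (x - c)^-1 * (df x - df c) < K.
    by move: H; rewrite -(opprB x c) -(opprB (df x)) invrN mulrNN.
  rewrite mulrC ltr_pdivrMr; last lra.
  move=> {}H; nra.
Qed.

Lemma is_derive_powR (a th : R) : 0 < th ->
  is_derive th 1 (fun x : R => x `^ a) (a * th `^ (a - 1)).
Proof.
move=> th0; have thin : th \in `]0, +oo[ by rewrite in_itv /= th0.
by apply: DeriveDef; [exact: derivable_powR|rewrite -derive1E powR_derive1].
Qed.

Definition barrier_exp (p : R) := (p - 2) / (p - 1).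
(** The critical point of - th^alpha / alpha + th^2 / 8, that is, the solution of th^(2 - alpha) =
    4. *)
Definition barrier_width (p : R) := 4 `^ (2 - barrier_exp p)^-1.
(** Minus the minimum of that function: s^alpha / alpha - s^2 / 8 with s^2 = 4 s^alpha. *)
Definition barrier_top (p : R) :=
  barrier_width p `^ barrier_exp p * ((barrier_exp p)^-1 - 2^-1).
(** The logarithm is completed so that the eta term is nonnegative and vanishes to first order at
    the width; the minimum stays there with value 0. *)
Definition barrier (p eta th : R) :=
  barrier_top p - th `^ barrier_exp p / barrier_exp p + th ^+ 2 / 8
  + eta * (- ln (th / barrier_width p) + th / barrier_width p - 1).
(** Minus the derivative of the barrier, so that it is nonnegative up to the width. *)
Definition barrier_slope (p eta th : R) :=
  th `^ (barrier_exp p - 1) - th / 4 + eta * (th^-1 - (barrier_width p)^-1).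
Definition barrier_curv (p eta th : R) :=
  (1 - barrier_exp p) * th `^ (barrier_exp p - 2) + 4^-1 + eta * th^-1 ^+ 2.

Lemma barrier_exp01 p : 2 < p -> 0 < barrier_exp p < 1.
Proof.
move=> p2; rewrite /barrier_exp; apply/andP; split; first by apply: divr_gt0; lra.
by rewrite ltr_pdivrMr ?mul1r ?subr_gt0; lra.
Qed.

Lemma barrier_width_gt0 p : 0 < barrier_width p.
Proof. by apply: powR_gt0. Qed.

Lemma barrier_width_powR p : 2 < p -> barrier_width p `^ (2 - barrier_exp p) = 4.
Proof.
move=> p2; have /andP[al0 al1] := barrier_exp01 p2; have s0 := barrier_width_gt0 p.
set al := barrier_exp p in al0 al1 *; set s := barrier_width p in s0 *.
rewrite /s /barrier_width -/al -powRrM mulVf ?powRr1 //.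
by rewrite gt_eqF // ; lra.
Qed.

Lemma barrier_width_sqr p : 2 < p -> barrier_width p ^+ 2 = 4 * barrier_width p `^ barrier_exp p.
Proof.
move=> p2; have /andP[al0 al1] := barrier_exp01 p2; have s0 := barrier_width_gt0 p.
set al := barrier_exp p in al0 al1 *; set s := barrier_width p in s0 *.
rewrite -(barrier_width_powR p2) -/s -/al -(powR_mulrn 2 (ltW s0)).
rewrite -powRD ?subrK //.
by rewrite (gt_eqF s0) implybT.
Qed.

(** The power s^alpha equals 2^(alpha + x) with x = alpha^2 / (2 - alpha) in [0, 1]. The chord bound
    2^x <= 1 + x leaves (1 + x) (1 - alpha / 2) = 1 - alpha / 2 + alpha^2 / 2, which is at most
    1. *)
Lemma barrier_top_le p : 2 < p -> barrier_top p <= 2 `^ barrier_exp p / barrier_exp p.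
Proof.
move=> p2; have /andP[al0 al1] := barrier_exp01 p2; have s0 := barrier_width_gt0 p.
set al := barrier_exp p in al0 al1 *; set s := barrier_width p in s0 *.
rewrite /barrier_top -/al /barrier_width -/al.
have a2 : 0 < 2 - al by lra.
have -> : (4 : R) = 2 `^ 2 by rewrite powR_mulrn // expr2; lra.
rewrite -!powRrM.
have -> : 2 * ((2 - al)^-1 * al) = al + al ^+ 2 / (2 - al) by field; rewrite gt_eqF.
rewrite powRD ?pnatr_eq0 ?implybT // -mulrA ler_pM2l ?powR_gt0 //.
set x := al ^+ 2 / (2 - al).
have x01 : 0 <= x <= 1.
  by rewrite /x divr_ge0 ?sqr_ge0 ?(ltW a2) //= ler_pdivrMr //; nra.
have -> : al^-1 - 2^-1 = (1 - al / 2) / al by field; rewrite gt_eqF.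
rewrite mulrA ler_pdivrMr // mulVf ?gt_eqF //.
have B : 2 `^ x <= 1 + x.
  have [x0|x0] := eqVneq x 0; first by rewrite x0 powRr0 addr0.
  have xp : 0 < x by rewrite lt0r x0; case/andP: x01.
  have [->|x1] := eqVneq x 1; first by rewrite powRr1.
  have xi : 1 < x^-1 by rewrite invf_gt1 // lt_neqAle x1; case/andP: x01.
  have := powR_bernoulli xi (powR_ge0 2 x).
  rewrite -powRrM mulfV // powRr1 // -(ler_pM2l xp) mulrDr mulrA mulfV //; lra.
apply: le_trans (ler_wpM2r _ B) _; first lra.
have xE : x * (2 - al) = al ^+ 2 by rewrite /x divfK // gt_eqF.
nra.
Qed.

(** With v = th / s, the profile without the eta term is s^alpha / 2 times v^2 - 1 - (2 / alpha)
    (v^alpha - 1), which is nonnegative by Bernoulli for v^alpha and the exponent 2 / alpha. *)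
Lemma barrier_ge p eta th : 2 < p -> 0 < th ->
  eta * (- ln (th / barrier_width p) + th / barrier_width p - 1) <= barrier p eta th.
Proof.
move=> p2; have /andP[al0 al1] := barrier_exp01 p2; have s0 := barrier_width_gt0 p.
set al := barrier_exp p in al0 al1 *; set s := barrier_width p in s0 *.
move=> th0; rewrite /barrier lerDr /barrier_top -/al -/s.
have v0 : 0 < th / s by exact: divr_gt0.
have thE : th = s * (th / s) by rewrite mulrCA mulfV ?gt_eqF // mulr1.
set v := th / s in v0 thE *; clearbody v; rewrite thE powRM ?(ltW v0) ?(ltW s0) //.
have m1 : 1 < 2 / al by rewrite ltr_pdivlMr; lra.
have := powR_bernoulli m1 (powR_ge0 v al).
rewrite -powRrM mulrCA mulfV ?gt_eqF // mulr1 powR_mulrn ?(ltW v0) //.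
have := barrier_width_sqr p2; rewrite -/s -/al => sq; rewrite exprMn sq.
set w := v `^ al; set S := s `^ al => H.
have S0 : 0 < S by exact: powR_gt0.
have -> : S * (al^-1 - 2^-1) - S * w / al + 4 * S * v ^+ 2 / 8 =
  S / 2 * (v ^+ 2 - (1 + 2 / al * (w - 1))) by field; rewrite gt_eqF.
by rewrite mulr_ge0 //; lra.
Qed.

Lemma barrier_log_ge0 p th : 2 < p -> 0 < th -> 0 <= - ln (th / barrier_width p) + th / barrier_width p - 1.
Proof.
move=> p2; have /andP[al0 al1] := barrier_exp01 p2; have s0 := barrier_width_gt0 p.
set al := barrier_exp p in al0 al1 *; set s := barrier_width p in s0 *.
move=> th0; have v0 : 0 < th / s by exact: divr_gt0.
have := expR_ge1Dx (ln (th / s)); rewrite lnK ?posrE //; lra.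
Qed.

Lemma barrier_ge0 p eta th : 2 < p -> 0 <= eta -> 0 < th -> 0 <= barrier p eta th.
Proof.
move=> p2; have /andP[al0 al1] := barrier_exp01 p2; have s0 := barrier_width_gt0 p.
set al := barrier_exp p in al0 al1 *; set s := barrier_width p in s0 *.
move=> e0 th0; apply: le_trans (barrier_ge _ p2 th0).
by rewrite mulr_ge0 // barrier_log_ge0.
Qed.

Lemma is_derive_barrier p eta th : 2 < p -> 0 < th ->
  is_derive th 1 (barrier p eta) (- barrier_slope p eta th).
Proof.
move=> p2; have /andP[al0 al1] := barrier_exp01 p2; have s0 := barrier_width_gt0 p.
set al := barrier_exp p in al0 al1 *; set s := barrier_width p in s0 *.
move=> th0.
have d1 := is_derive_powR al th0.
have d2 : is_derive th 1 (fun x : R => ln (x / s)) th^-1.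
  have d0 : is_derive th 1 (fun x : R => x / s) (s^-1).
    by apply: is_derive_eq; rewrite /GRing.scale /= mulr0 add0r mulr1.
  have dl : is_derive (th / s) 1 (@ln R) (th / s)^-1.
    by apply: is_derive1_ln; rewrite divr_gt0.
  have := is_derive1_comp (f := @ln R) (g := fun x => x / s) dl d0.
  by move=> d; apply: is_derive_eq; rewrite /GRing.scale /=; field; rewrite !gt_eqF.
rewrite /barrier; apply: is_derive_eq; rewrite /GRing.scale /= /barrier_slope -/al -/s.
by field; rewrite !gt_eqF.
Qed.

Lemma is_derive_barrier_slope p eta th : 2 < p -> 0 < th ->
  is_derive th 1 (fun x => - barrier_slope p eta x) (barrier_curv p eta th).
Proof.
move=> p2; have /andP[al0 al1] := barrier_exp01 p2; have s0 := barrier_width_gt0 p.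
set al := barrier_exp p in al0 al1 *; set s := barrier_width p in s0 *.
move=> th0.
have d1 := is_derive_powR (al - 1) th0.
have d2 : is_derive th 1 (fun x : R => x^-1) (- th^-1 ^+ 2).
  have thn : th != 0 by rewrite gt_eqF.
  have := is_deriveV thn (@is_derive_id _ R th 1).
  by move=> d; apply: is_derive_eq; rewrite /GRing.scale /= mulr1 exprVn.
rewrite /barrier_slope; apply: is_derive_eq; rewrite /GRing.scale /= /barrier_curv -/al.
rewrite (_ : al - 1 - 1 = al - 2); last ring.
by field; rewrite !gt_eqF.
Qed.

End Barrier.

(** * Differential inequality for the profile *)

Section BarrierODE.
Context {R : realType}.
Implicit Types (p eta th : R).

Lemma mulr_ge1_half (a b : R) : 2 <= a -> 2^-1 <= b -> 1 <= a * b.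
Proof.
move=> a2 b2; have : 0 <= (a - 2) * b by rewrite mulr_ge0 //; lra.
lra.
Qed.

(** Multiplied by th^(alpha - 2) with z = (th / s)^(2 - alpha), the term 2 z becomes the constant 1
    / 2, and the rest bounds the singular part of the curvature by the power p of the slope. *)
Lemma barrier_young p (z : R) : 2 < p -> 0 <= z <= 1 ->
  1 - barrier_exp p <= (1 - barrier_exp p / 2) * (1 - z) `^ p + 2 * z.
Proof.
move=> p2 /andP[z0 z1]; have p1 : 0 < p - 1 by lra.
have -> : 1 - barrier_exp p = (p - 1)^-1 by rewrite /barrier_exp; field; rewrite gt_eqF.
have -> : 1 - barrier_exp p / 2 = p / 2 / (p - 1).
  by rewrite /barrier_exp; field; rewrite gt_eqF.
have t0 : 0 <= 1 - z by lra.
have := @powR_bernoulli R p (1 - z) _ t0; move=> /(_ ltac:(lra)) B.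
have tp := powR_ge0 (1 - z) p.
rewrite -(ler_pM2r p1) mulVf ?gt_eqF // mulrDl mulrAC divfK ?gt_eqF //.
have : 0 <= (p - 2) * z by rewrite mulr_ge0 //; lra.
have : 0 <= (p - 2) * (1 - z) `^ p by rewrite mulr_ge0 //; lra.
lra.
Qed.

(** These identities single out alpha: p (alpha - 1) = alpha - 2, so the slope to the power p has
    the order of the curvature, and (p - 1) (alpha - 1) = -1. *)
Lemma powR_barrier_expB p th : 2 < p -> 0 < th ->
  [/\ th `^ (barrier_exp p - 2) = (th `^ (2 - barrier_exp p))^-1,
      th `^ (barrier_exp p - 1) = th * (th `^ (2 - barrier_exp p))^-1,
      (th `^ (barrier_exp p - 1)) `^ p = th `^ (barrier_exp p - 2) &
      (th `^ (barrier_exp p - 1)) `^ (p - 1) = th^-1].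
Proof.
move=> p2 th0; have p1 : 0 < p - 1 by lra.
have E1 : th `^ (barrier_exp p - 2) = (th `^ (2 - barrier_exp p))^-1.
  by rewrite -powRN opprB.
split=> //.
- rewrite -E1 -{2}(powRr1 (ltW th0)) -powRD; last by rewrite (gt_eqF th0) implybT.
  by congr (_ `^ _); ring.
- rewrite -powRrM; congr (_ `^ _); rewrite /barrier_exp; field; exact: lt0r_neq0.
- rewrite -powRrM -powR_inv1 ?(ltW th0) //; congr (_ `^ _).
  rewrite /barrier_exp; field; exact: lt0r_neq0.
Qed.

Lemma powR_barrier_widthE p th : 2 < p -> 0 < th ->
  th `^ (2 - barrier_exp p) = 4 * (th / barrier_width p) `^ (2 - barrier_exp p).
Proof.
move=> p2 th0; have s0 := barrier_width_gt0 p.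
rewrite -(barrier_width_powR p2) -powRM ?(ltW s0) ?divr_ge0 ?(ltW th0) ?(ltW s0) //.
by rewrite mulrCA mulfV ?gt_eqF // mulr1.
Qed.

Lemma barrier_slope_le0 p eta th : 2 < p -> 0 <= eta -> barrier_width p <= th ->
  barrier_slope p eta th <= 0.
Proof.
move=> p2 e0 sth; have s0 := barrier_width_gt0 p; have th0 := lt_le_trans s0 sth.
have /andP[al0 al1] := barrier_exp01 p2.
have [_ E2 _ _] := powR_barrier_expB p2 th0.
have h : (th `^ (2 - barrier_exp p))^-1 <= 4^-1.
  rewrite lef_pV2 ?posrE ?powR_gt0 // -(barrier_width_powR p2).
  by apply: ge0_ler_powR; rewrite ?nnegrE ?(ltW s0) ?(ltW th0) //; lra.
have h2 : th^-1 - (barrier_width p)^-1 <= 0 by rewrite subr_le0 lef_pV2 ?posrE.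
have h3 := ler_wpM2l (ltW th0) h; have h4 := mulr_ge0_le0 e0 h2.
rewrite /barrier_slope E2; lra.
Qed.

(** Past the width the slope has the wrong sign to help, but th^(alpha - 2) <= 1 / 4 makes the
    curvature small by itself. *)
Lemma barrier_curv_le p eta th : 2 < p -> eta <= barrier_width p ^+ 2 / 4 ->
  barrier_width p <= th -> barrier_curv p eta th <= 7 / 8.
Proof.
move=> p2 e0 sth; have s0 := barrier_width_gt0 p; have th0 := lt_le_trans s0 sth.
have /andP[al0 al1] := barrier_exp01 p2.
have [E1 _ _ _] := powR_barrier_expB p2 th0.
have h : (th `^ (2 - barrier_exp p))^-1 <= 4^-1.
  rewrite lef_pV2 ?posrE ?powR_gt0 // -(barrier_width_powR p2).
  by apply: ge0_ler_powR; rewrite ?nnegrE ?(ltW s0) ?(ltW th0) //; lra.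
have h0 : 0 < (th `^ (2 - barrier_exp p))^-1 by rewrite invr_gt0 powR_gt0.
have h2 : eta * th^-1 ^+ 2 <= 4^-1.
  rewrite exprVn ler_pdivrMr ?exprn_gt0 //; apply: le_trans e0 _.
  have : barrier_width p ^+ 2 <= th ^+ 2 by rewrite ler_pXn2r ?nnegrE ?(ltW s0) ?(ltW th0).
  lra.
have : 0 <= barrier_exp p * (th `^ (2 - barrier_exp p))^-1 by rewrite mulr_ge0 // ltW.
rewrite /barrier_curv E1; lra.
Qed.

Lemma barrier_curv_ge0 p eta th : 2 < p -> 0 <= eta -> 0 <= barrier_curv p eta th.
Proof.
move=> p2 e0; have /andP[al0 al1] := barrier_exp01 p2.
have a0 : 0 <= 1 - barrier_exp p by lra.
apply: addr_ge0; last by rewrite mulr_ge0 ?sqr_ge0.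
by apply: addr_ge0; rewrite ?mulr_ge0 ?powR_ge0 ?invr_ge0.
Qed.

(** Up to the width, the slope term pays for the curvature with the factor 1 - alpha / 2 only; the
    remaining alpha / 2 is kept for the geometry of the ball. In 7 / 8, the quadratic term
    contributes 1 / 4, [barrier_young] 1 / 2, and the logarithm 1 / 8. *)
Lemma barrier_ode p eta th : 2 < p ->
  0 <= eta -> eta <= barrier_width p ^+ 2 / (32 * p ^+ 2) -> 0 < th <= barrier_width p ->
  0 <= barrier_slope p eta th /\
  barrier_curv p eta th <= (1 - barrier_exp p / 2) * barrier_slope p eta th `^ p + 7 / 8.
Proof.
move=> p2 e0 eS /andP[th0 ths]; have s0 := barrier_width_gt0 p.
have /andP[al0 al1] := barrier_exp01 p2.
have [E1 E2 E3 E4] := powR_barrier_expB p2 th0.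
have E5 := powR_barrier_widthE p2 th0.
set s := barrier_width p in s0 ths eS E5 *; set al := barrier_exp p in al0 al1 E1 E2 E3 E4 E5 *.
set v := th / s in E5; set z := v `^ (2 - al) in E5.
have v0 : 0 < v by exact: divr_gt0.
have v1 : v <= 1 by rewrite ler_pdivrMr // mul1r.
have zv : z <= v by apply: ge1r_powR; rewrite ?v0 ?v1 //; lra.
have z0 : 0 < z by exact: powR_gt0.
have z1 : z <= 1 by lra.
set T := th `^ (al - 2) in E1 E3.
have T0 : 0 < T by exact: powR_gt0.
have Tz : T * z = 4^-1 by rewrite E1 E5; field; rewrite gt_eqF.
have y0E : th `^ (al - 1) - th / 4 = th `^ (al - 1) * (1 - z).
  by rewrite E2 -E1 -Tz; ring.
set w := th `^ (al - 1) in E2 E3 E4 y0E.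
have w0 : 0 < w by exact: powR_gt0.
have curvE : barrier_curv p eta th = (1 - al) * T + 4^-1 + eta * th^-1 ^+ 2 by [].
have slE : barrier_slope p eta th = w * (1 - z) + eta * (th^-1 - s^-1).
  by rewrite -y0E.
have vE : v = th / s by [].
have yng := @barrier_young p z p2; rewrite (ltW z0) z1 in yng; have {}yng := yng isT.
rewrite -/al in yng.
have z1n : 0 <= 1 - z by lra.
rewrite curvE slE; clear curvE slE.
clearbody w T z v.
have m0 : 0 <= th^-1 - s^-1 by rewrite subr_ge0 lef_pV2 ?posrE.
have mE : th^-1 - s^-1 = th^-1 * (1 - v) by rewrite vE; field; rewrite !gt_eqF.
set m := th^-1 - s^-1 in m0 mE *; clearbody m.
have y0p : (w * (1 - z)) `^ p = T * (1 - z) `^ p by rewrite (powRM p (ltW w0) z1n) E3.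
have y0q : (w * (1 - z)) `^ (p - 1) = th^-1 * (1 - z) `^ (p - 1).
  by rewrite (powRM (p - 1) (ltW w0) z1n) E4.
clear E1 E2 E3 E4 E5 y0E.
have y00 : 0 <= w * (1 - z) by rewrite mulr_ge0 ?(ltW w0).
have y0gt : z < 1 -> 0 < w * (1 - z) by move=> z1'; rewrite mulr_gt0 //; lra.
set y0 := w * (1 - z) in y0p y0q y00 y0gt *; clearbody y0.
have em0 : 0 <= eta * m by exact: mulr_ge0.
have base : (1 - al) * T + 4^-1 <= (1 - al / 2) * y0 `^ p + 3 / 4.
  rewrite y0p; have := ler_wpM2l (ltW T0) yng; lra.
split; first by rewrite addr_ge0.
have a2 : 0 < 1 - al / 2 by lra.
(* Near 0 the logarithmic curvature eta / th^2 is absorbed by the increase of the slope term,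
   estimated by its tangent at eta = 0: the gain is p A eta / th^2 with A >= 1 / 2, and (1 - alpha /
   2) p >= 2 amounts to (p - 2)^2 >= 0. *)
have [vp|vp] := leP v (2 * p)^-1.
- have p0 : 0 < p by lra.
  have pv : p * v <= 2^-1.
    have : v * (2 * p) <= 1 by rewrite -ler_pdivlMr ?mulr_gt0 // mul1r.
    lra.
  have z1' : z < 1.
    have : 0 <= (p - 2) * v by rewrite mulr_ge0 ?(ltW v0) //; lra.
    lra.
  have y0p0 := y0gt z1'.
  have p1 : 1 < p by lra.
  have tan := powR_tangent p1 y0p0 (addr_ge0 y00 em0).
  have sub : y0 + eta * m - y0 = eta * m by ring.
  rewrite sub y0q in tan.
  have bern : 1 - (p - 1) * z <= (1 - z) `^ (p - 1).
    have p11 : 1 < p - 1 by lra.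
    by have := powR_bernoulli p11 z1n; lra.
  have prod : 2^-1 <= (1 - z) `^ (p - 1) * (1 - v).
    apply: le_trans (ler_wpM2r _ bern); last by lra.
    have : (p - 1) * z <= (p - 1) * v by rewrite ler_pM2l //; lra.
    have : 0 <= (p - 1) * z * v by rewrite !mulr_ge0 ?(ltW z0) ?(ltW v0) //; lra.
    lra.
  have c2 : 2 <= (1 - al / 2) * p.
    have -> : 1 - al / 2 = p / 2 / (p - 1).
      rewrite /al /barrier_exp; field; rewrite gt_eqF //; lra.
    have := sqr_ge0 (p - 2); rewrite mulrAC ler_pdivlMr; lra.
  set A := (1 - z) `^ (p - 1) * (1 - v) in prod.
  have E7 : p * (th^-1 * (1 - z) `^ (p - 1)) * (eta * m) = p * A * (eta * th^-1 ^+ 2).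
    by rewrite mE /A; ring.
  rewrite E7 in tan.
  set X := eta * th^-1 ^+ 2 in tan *.
  have X0 : 0 <= X by rewrite mulr_ge0 // sqr_ge0.
  clearbody A X.
  have : X <= (1 - al / 2) * (p * A * X).
    have -> : (1 - al / 2) * (p * A * X) = (1 - al / 2) * p * A * X by ring.
    by rewrite ler_peMl // (mulr_ge1_half c2 prod).
  have := ler_wpM2l (ltW a2) tan; lra.
- have mono : y0 `^ p <= (y0 + eta * m) `^ p.
    by apply: ge0_ler_powR; rewrite ?nnegrE ?addr_ge0 //; lra.
  (* Away from 0 the bound on eta suffices: th > s / (2 p) turns s^2 / (32 p^2) into 1 / 8. *)
  have X8 : eta * th^-1 ^+ 2 <= 8^-1.
    have p0 : 0 < p by lra.
    have thv : s < th * (2 * p).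
      by move: vp; rewrite vE ltr_pdivlMr // mulrC ltr_pdivrMr // mulr_gt0.
    rewrite exprVn ler_pdivrMr ?exprn_gt0 //; apply: le_trans eS _.
    rewrite ler_pdivrMr ?mulr_gt0 ?exprn_gt0 //.
    have : s ^+ 2 <= (th * (2 * p)) ^+ 2.
      rewrite ler_pXn2r ?nnegrE ?(ltW s0) ?(ltW thv) //.
      by rewrite mulr_ge0 ?(ltW th0) //; lra.
    rewrite !exprMn; lra.
  have := ler_wpM2l (ltW a2) mono; lra.
Qed.

End BarrierODE.

(** * Radial supersolution inequality on a ball *)

Section BallComparison.
Context {R : realType} {n : nat}.
Notation V := 'rV[R]_n.
Implicit Types (x c : V) (p lam eps r eta : R).

Lemma SC_sub_quartic (O : set V) lam p eps (f u : V -> R) x c (k a b : R) :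
  SC_solution O lam p eps f u -> O x ->
  (\forall y \near x, u y - quartic c 0 k a b y <= u x - quartic c 0 k a b x) ->
  lam * u x + sqn ((2 * a + 4 * b * sqn (x - c)) *: (x - c)) `^ (p / 2)
   - eps * (8 * b * sqn (x - c) + (2 * a + 4 * b * sqn (x - c)) * n%:R) <= f x.
Proof.
move=> [_ [sub _]] Ox /near_sqn_ball[d d0 hd].
have := sub (quartic c 0 k a b) x (test_fun_quartic _ _ _ _ _ _) Ox.
rewrite /SC_op grad_quartic lap_quartic enorm_powR add0r; apply.
by exists d; split => // y _; rewrite enorm_ltE // => /hd.
Qed.

Lemma ball_segment (c x : V) (r t : R) : sqn (x - c) = r ^+ 2 ->
  sqn (x + t *: (c - x) - c) = (1 - t) ^+ 2 * r ^+ 2 /\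
  sqn (x + t *: (c - x) - x) = t ^+ 2 * r ^+ 2.
Proof.
move=> xr; split.
  have -> : x + t *: (c - x) - c = (1 - t) *: (x - c).
    by rewrite addrAC scalerBl scale1r -(opprB x c) scalerN.
  by rewrite sqnZ xr.
have -> : x + t *: (c - x) - x = t *: (c - x) by rewrite addrAC subrr add0r.
by rewrite sqnZ -opprB sqnN xr.
Qed.

Lemma closed_ball_closure (O : set V) c r : 0 < r ->
  (forall x, sqn (x - c) < r ^+ 2 -> O x) ->
  forall x, sqn (x - c) <= r ^+ 2 -> closure O x.
Proof.
move=> r0 BO x; rewrite le_eqVlt => /orP[/eqP xr|/BO]; last exact: subset_closure.
move=> A /near_sqn_ball[d d0 hd].
have r20 : 0 < r ^+ 2 by exact: exprn_gt0.
pose t := Num.min 2^-1 (d / (2 * r)).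
have t0 : 0 < t by rewrite lt_min invr_gt0 ltr0n divr_gt0 // mulr_gt0.
have t1 : t <= 2^-1 by rewrite ge_min lexx.
have td : t * r <= d / 2.
  have : t <= d / (2 * r) by rewrite ge_min lexx orbT.
  rewrite ler_pdivlMr ?mulr_gt0 //; lra.
have [e1 e2] := ball_segment t xr; exists (x + t *: (c - x)); split.
  apply: BO; rewrite e1 gtr_pMl // expr_lt1 //; lra.
have tr0 : 0 <= t * r by rewrite mulr_ge0 ?(ltW t0) ?(ltW r0).
by apply: hd; rewrite e2 -exprMn ltr_pXn2r ?nnegrE ?(ltW d0) //; lra.
Qed.

(* In the application [m] is |x - c|^2 / r^2 and [k] is sqrt eps / r. *)
Lemma barrier_supersolution p eta th (k m : R) : 2 < p ->
  0 <= eta -> eta <= barrier_width p ^+ 2 / (32 * p ^+ 2) -> 0 < th ->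
  0 <= k -> k * n%:R <= barrier_exp p / 16 -> k * p * barrier_width p <= barrier_exp p / 4 ->
  m = 1 - 2 * k * th -> 0 <= m ->
  (barrier_curv p eta th + 16^-1) * m + k * n%:R * barrier_slope p eta th
    - (barrier_slope p eta th ^+ 2 * m) `^ (p / 2) <= 1.
Proof.
move=> p2 e0 eS th0 k0 kn ks mE m0.
have /andP[al0 al1] := barrier_exp01 p2; have s0 := barrier_width_gt0 p.
have kn0 : 0 <= k * n%:R by rewrite mulr_ge0.
have m1 : m <= 1.
  have : 0 <= k * th by rewrite mulr_ge0 // ltW.
  lra.
have cm : (barrier_curv p eta th + 16^-1) * m <= barrier_curv p eta th + 16^-1.
  by rewrite ler_piMr //; have := @barrier_curv_ge0 _ p eta th p2 e0; lra.
have [ths|sth] := leP th (barrier_width p); last first.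
  have P0 := powR_ge0 (barrier_slope p eta th ^+ 2 * m) (p / 2).
  have e4 : eta <= barrier_width p ^+ 2 / 4.
    have p0 : 0 < p by lra.
    apply: le_trans eS _; rewrite ler_pM2l ?exprn_gt0 //.
    rewrite lef_pV2 ?posrE ?mulr_gt0 ?exprn_gt0 //.
    have : 1 <= p ^+ 2 by rewrite expr_ge1 //; lra.
    lra.
  have c1 := barrier_curv_le p2 e4 (ltW sth).
  have y0 := barrier_slope_le0 p2 e0 (ltW sth).
  have : k * n%:R * barrier_slope p eta th <= 0 by rewrite mulr_ge0_le0.
  lra.
have thI : 0 < th <= barrier_width p by rewrite th0.
have [y0 ode] := barrier_ode p2 e0 eS thI.
set y := barrier_slope p eta th in y0 ode *.
have -> : (y ^+ 2 * m) `^ (p / 2) = y `^ p * m `^ (p / 2).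
  by rewrite powRM ?sqr_ge0 // -powR_mulrn // -powRrM; congr (_ `^ _ * _); field.
have Y0 := powR_ge0 y p.
have yY : y <= 1 + y `^ p.
  have [y1|y1] := leP y 1; first lra.
  have p1 : 1 <= p by lra.
  have := le1r_powR (ltW y1) p1; lra.
(* Bernoulli for m = 1 - 2 k th. In total the slope power gets the coefficient (1 - alpha / 2) +
   alpha / 16 - (1 - alpha / 4) < 0, and the constants 7 / 8 + 1 / 16 + alpha / 16 stay below 1. *)
have mp : 1 - barrier_exp p / 4 <= m `^ (p / 2).
  have p12 : 1 < p / 2 by lra.
  have := powR_bernoulli p12 m0.
  have : k * p * th <= k * p * barrier_width p.
    by rewrite ler_wpM2l // mulr_ge0 //; lra.
  rewrite mE; lra.
have h1 : k * n%:R * y <= barrier_exp p / 16 * (1 + y `^ p).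
  apply: le_trans (ler_wpM2l kn0 yY) _; rewrite ler_wpM2r //; lra.
have h2 : (1 - barrier_exp p / 4) * y `^ p <= y `^ p * m `^ (p / 2).
  by rewrite mulrC ler_wpM2l.
have h3 : 0 <= barrier_exp p * y `^ p by rewrite mulr_ge0 // ltW.
lra.
Qed.

(** The gradient of E H(d / sqrt eps) has square E^2 / eps times the squared slope; with E = eps^(1
    - alpha / 2) its power p / 2 is again of size E, as is the viscous term. *)
Lemma scale_powR p eps : 2 < p -> 0 < eps ->
  ((eps `^ (1 - barrier_exp p / 2)) ^+ 2 / eps) `^ (p / 2) = eps `^ (1 - barrier_exp p / 2).
Proof.
move=> p2 e0.
have -> : (eps `^ (1 - barrier_exp p / 2)) ^+ 2 / eps = eps `^ (1 - barrier_exp p).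
  rewrite -powR_mulrn ?powR_ge0 // -powRrM -(powR_inv1 (ltW e0)).
  rewrite -powRD; last by rewrite (gt_eqF e0) implybT.
  by congr (_ `^ _); field.
rewrite -powRrM; congr (_ `^ _); rewrite /barrier_exp; field.
by apply/eqP; lra.
Qed.

Lemma continuous_barrier p eta th : 2 < p -> 0 < th -> {for th, continuous (barrier p eta)}.
Proof.
move=> p2 th0; apply: differentiable_continuous; apply/derivable1_diffP.
by have [] := is_derive_barrier eta p2 th0.
Qed.

End BallComparison.

(** * Comparison of a subsolution with the barrier *)

Section BallBarrier.
Context {R : realType} {n : nat}.
Notation V := 'rV[R]_n.
Implicit Types (x c : V) (p lam eps r eta : R).

(** For eta > 0 the difference v - E H has an interior maximum x0. There the supersolution
    inequality for the barrier gives lam v(x0) <= E, and H >= 0 bounds the maximum by E / lam. No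
    information on v at the sphere beyond continuity is required. *)
Lemma ball_barrier (O : set V) (f v : V -> R) c p lam eps eta r :
  2 < p -> 0 < lam -> 0 < r -> 0 < eps -> SC_solution O lam p eps f v ->
  (forall x, sqn (x - c) < r ^+ 2 -> O x /\ f x = 0) ->
  0 < eta -> eta <= barrier_width p ^+ 2 / (32 * p ^+ 2) ->
  Num.sqrt eps / r * n%:R <= barrier_exp p / 16 ->
  Num.sqrt eps / r * p * barrier_width p <= barrier_exp p / 4 ->
  forall x, sqn (x - c) < r ^+ 2 ->
    v x <= eps `^ (1 - barrier_exp p / 2) * (lam^-1 +
      barrier p eta ((r ^+ 2 - sqn (x - c)) / (2 * r * Num.sqrt eps))).
Proof.
move=> p2 lam0 r0 e0 sol BO et0 etS kn ks.
set se := Num.sqrt eps in kn ks *; set E := eps `^ _.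
have se0 : 0 < se by rewrite sqrtr_gt0.
have se2 : se ^+ 2 = eps by rewrite sqr_sqrtr // ltW.
have E0 : 0 < E by exact: powR_gt0.
pose D := 2 * r * se; have D0 : 0 < D by rewrite !mulr_gt0.
pose th x := (r ^+ 2 - sqn (x - c)) / D.
pose H := barrier p eta; pose F x := v x - E * H (th x).
have BO' x : sqn (x - c) < r ^+ 2 -> O x by move/BO => [].
have clB := closed_ball_closure r0 BO'.
have r20 : 0 < r ^+ 2 by exact: exprn_gt0.
have cN x : {for x, continuous (fun x : V => sqn (x - c))}.
  apply: (@continuous_sqn _ _ _ (fun x : V => x - c)).
  by apply: continuousB; [exact: id|exact: cst_continuous].
have cth x : {for x, continuous th}.
  apply: (@continuousM _ _ (cst (r ^+ 2) - (fun x : V => sqn (x - c))) (cst D^-1)).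
    by apply: continuousB; [exact: cst_continuous|exact: cN].
  exact: cst_continuous.
have thgt0 x : sqn (x - c) < r ^+ 2 -> 0 < th x.
  by move=> xr; rewrite divr_gt0 // subr_gt0.
have [cv _] := sol.
have [||z _ hz] := @compact_max _ _ v [set x | sqn (x - c) <= r ^+ 2] _ (@compact_sqn_ball _ _ c (r ^+ 2)).
- by exists c; rewrite /= subrr sqn0 ltW.
- by apply: continuous_subspaceW cv => x /=; exact: clB.
have cB : sqn (c - c) < r ^+ 2 by rewrite subrr sqn0.
pose L := v z - F c.
pose t1 := barrier_width p * expR (- (L / (E * eta) + 1)).
have s0 := barrier_width_gt0 p.
have t10 : 0 < t1 by rewrite mulr_gt0 ?expR_gt0.
have low x : sqn (x - c) < r ^+ 2 -> th x < t1 -> F x < F c.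
  move=> xB xt; have t0 := thgt0 _ xB.
  have hb := barrier_ge eta p2 t0.
  have tv : 0 < th x / barrier_width p by exact: divr_gt0.
  have ln1 : ln (th x / barrier_width p) < - (L / (E * eta) + 1).
    rewrite -ltr_expR lnK ?posrE // ltr_pdivrMr // mulrC; exact: xt.
  have EL : E * (eta * (L / (E * eta))) = L by field; rewrite !gt_eqF.
  have hL : L / (E * eta) < - ln (th x / barrier_width p) + th x / barrier_width p - 1 by lra.
  have hE : L < E * H (th x).
    rewrite -{1}EL ltr_pM2l //; apply: lt_le_trans hb; by rewrite ltr_pM2l.
  have := hz x (ltW xB); rewrite /F -/H; move: hE; rewrite /L /F; lra.
have [||x0 x0K hx0] := @compact_max _ _ F [set x | sqn (x - c) <= r ^+ 2 - t1 * D] _ (@compact_sqn_ball _ _ c _).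
- exists c => /=; rewrite leNgt; apply/negP => cK.
  by have := low c cB; rewrite ltxx => /(_ _)/negP[] //; rewrite /th ltr_pdivrMr //; lra.
- have cvK : {within [set x | sqn (x - c) <= r ^+ 2 - t1 * D], continuous v}.
    apply: continuous_subspaceW cv => x /= xK; apply: clB.
    by have : 0 < t1 * D by [exact: mulr_gt0]; lra.
  apply/subspace_continuousP => x /= xK.
  have xB : sqn (x - c) < r ^+ 2.
    by have : 0 < t1 * D by [exact: mulr_gt0]; lra.
  have /subspace_continuousP/(_ x xK) h1 := cvK.
  have cH : {for x, continuous (H \o th)}.
    by apply: continuous_comp; [exact: cth|exact: continuous_barrier p2 (thgt0 _ xB)].
  have cEH : {for x, continuous (cst E * (H \o th))}.
    by apply: continuousM; [exact: cst_continuous|exact: cH].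
  exact: cvgB h1 (cvg_within_filter _ cEH).
have tD0 : 0 < t1 * D by exact: mulr_gt0.
have x0B : sqn (x0 - c) < r ^+ 2 by move: x0K => /=; lra.
have Fmax x : sqn (x - c) < r ^+ 2 -> F x <= F x0.
  move=> xB; have [xt|xt] := ltP (th x) t1.
    have [ct|ct] := ltP (th c) t1; first by have := low c cB ct; rewrite ltxx.
    apply: le_trans (ltW (low x xB xt)) (hx0 c _).
    by move: ct; rewrite /= /th ler_pdivlMr //; lra.
  by apply: hx0; move: xt; rewrite /= /th ler_pdivlMr //; lra.
have t0 := thgt0 _ x0B.
set N0 := sqn (x0 - c) in x0B.
(* The 1 / 16 is the strict room required by [second_order_touch], already budgeted in
   [barrier_supersolution]. *)
pose y := barrier_slope p eta (th x0); pose K := barrier_curv p eta (th x0) + 16^-1.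
have near_th : \forall t \near th x0,
    H t <= H (th x0) + - y * (t - th x0) + K / 2 * (t - th x0) ^+ 2.
  apply: (@second_order_touch _ _ (fun t => - barrier_slope p eta t) _ (barrier_curv p eta (th x0))).
  - near=> t; apply: is_derive_barrier => //; near: t.
    exact: lt_nbhsr.
  - exact: is_derive_barrier_slope.
  - by rewrite /K; lra.
have touch : \forall x \near x0,
    H (th x) <= H (th x0) + - y * (th x - th x0) + K / 2 * (th x - th x0) ^+ 2.
  exact: (cth x0 _ near_th).
have near_ball : \forall x \near x0, sqn (x - c) < r ^+ 2.
  exact: (cvgr_lt _ (cN x0)).
(* Since th is affine in |x - c|^2, the quadratic in th is a polynomial of degree two in |x - c|^2;
   these are its coefficients, up to the additive constant. *)
pose a := E * y / D - E * K * N0 / D ^+ 2; pose b := E * K / D ^+ 2 / 2.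
have loc : \forall x \near x0, v x - quartic c 0 0 a b x <= v x0 - quartic c 0 0 a b x0.
  near=> x.
  have xB : sqn (x - c) < r ^+ 2 by near: x.
  have h1 := Fmax x xB.
  have h2 : H (th x) <= H (th x0) + - y * (th x - th x0) + K / 2 * (th x - th x0) ^+ 2.
    by near: x.
  have h3 := ler_wpM2l (ltW E0) h2.
  have h4 : quartic c 0 0 a b x - quartic c 0 0 a b x0 =
     E * (- y * (th x - th x0) + K / 2 * (th x - th x0) ^+ 2).
    rewrite /quartic !dot0l /a /b /th -/N0; field; exact: lt0r_neq0.
  move: h1 h3; rewrite /F; lra.
have := SC_sub_quartic sol (BO' _ x0B) loc.
rewrite (BO _ x0B).2 -/N0.
have -> : 2 * a + 4 * b * N0 = 2 * E * y / D by rewrite /a /b; field; exact: lt0r_neq0.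
pose m := N0 / r ^+ 2.
have -> : sqn ((2 * E * y / D) *: (x0 - c)) = E ^+ 2 / eps * (y ^+ 2 * m).
  rewrite sqnZ -/N0 -se2 /m /D; field; by rewrite !gt_eqF.
have m0 : 0 <= m by rewrite divr_ge0 ?sqn_ge0 // ltW.
rewrite powRM ?scale_powR //; last 2 first.
- by rewrite divr_ge0 ?sqr_ge0 // ltW.
- by rewrite mulr_ge0 // sqr_ge0.
rewrite -/E.
have -> : eps * (8 * b * N0 + 2 * E * y / D * n%:R) = E * (K * m + se / r * n%:R * y).
  rewrite -se2 /b /m /D; field; by rewrite !gt_eqF.
have k0 : 0 <= se / r by rewrite divr_ge0 ?ltW.
have mE : m = 1 - 2 * (se / r) * th x0.
  rewrite /m /th -/N0 /D; field; by rewrite !gt_eqF.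
have := @barrier_supersolution _ n p eta (th x0) (se / r) m p2 (ltW et0) etS t0 k0 kn ks mE m0.
rewrite -/y -/K => ss sub x xB.
have lv : lam * v x0 <= E by have := ler_wpM2l (ltW E0) ss; lra.
have {}lv : v x0 <= E * lam^-1 by rewrite ler_pdivlMr // mulrC.
have Hge : 0 <= H (th x0) by apply: barrier_ge0 => //; exact: ltW.
have := Fmax x xB; have := mulr_ge0 (ltW E0) Hge; rewrite /F -/(th x) -/H mulrDr; lra.
Unshelve. all: by end_near. Qed.

End BallBarrier.

(** * Bound at the sphere of an interior ball *)

Section BallEstimate.
Context {R : realType} {n : nat}.
Notation V := 'rV[R]_n.
Implicit Types (x c : V) (p lam eps r : R).

Lemma le0_of_small (X W d : R) : 0 < d -> (forall e, 0 < e <= d -> X <= e * W) -> X <= 0.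
Proof.
move=> d0 h; rewrite leNgt; apply/negP => X0.
have W0 : 0 < W.
  have dd : 0 < d <= d by rewrite d0 lexx.
  by have := lt_le_trans X0 (h d dd); rewrite pmulr_rgt0.
pose e := Num.min d (X / (2 * W)).
have e0 : 0 < e by rewrite lt_min d0 divr_gt0 // mulr_gt0.
have eX : e * W <= X / 2.
  have : e <= X / (2 * W) by rewrite ge_min lexx orbT.
  rewrite ler_pdivlMr ?mulr_gt0 //; lra.
have ed : 0 < e <= d by rewrite e0 ge_min lexx.
have := h e ed; lra.
Qed.

(** The threshold on eps is chosen before the centre, the domain and f, so it serves all boundary
    points at once. The bound inside the ball is taken to the limit eta -> 0 and then to the sphere,
    where th = 0. *)
Lemma ball_estimate p lam r : 2 < p -> 0 < lam -> 0 < r ->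
  exists2 eps0, 0 < eps0 &
  forall (O : set V) (f v : V -> R) c eps, 0 < eps < eps0 ->
    SC_solution O lam p eps f v ->
    (forall x, sqn (x - c) < r ^+ 2 -> O x /\ f x = 0) ->
    forall x, sqn (x - c) = r ^+ 2 ->
      v x <= eps `^ (1 - barrier_exp p / 2) *
             (lam^-1 + 2 `^ barrier_exp p / barrier_exp p).
Proof.
move=> p2 lam0 r0; have /andP[al0 al1] := barrier_exp01 p2.
have s0 := barrier_width_gt0 p; have ps0 : 0 < p * barrier_width p by rewrite mulr_gt0 //; lra.
(* A single number above both n and p times the width: sqrt eps / r <= [kap] then gives both
   smallness conditions of [ball_barrier]. *)
pose A := (n%:R + 1) * (p * barrier_width p + 1) : R.
have n0 : 0 <= n%:R :> R by [].
have A1 : n%:R <= A.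
  have : 0 <= n%:R * (p * barrier_width p) by rewrite mulr_ge0 // ltW.
  rewrite /A; lra.
have A2 : p * barrier_width p <= A.
  have : 0 <= n%:R * (p * barrier_width p) by rewrite mulr_ge0 // ltW.
  rewrite /A; lra.
have A0 : 0 < A by lra.
pose kap := barrier_exp p / 16 / A.
have kap0 : 0 < kap by rewrite divr_gt0 // divr_gt0.
exists ((kap * r) ^+ 2); first by rewrite exprn_gt0 // mulr_gt0.
move=> O f v c eps /andP[e0 eE] sol BO x xr.
set E := eps `^ _.
have E0 : 0 < E by exact: powR_gt0.
pose se := Num.sqrt eps; have se0 : 0 < se by rewrite sqrtr_gt0.
have sek : se / r <= kap.
  have kr0 : 0 <= kap * r by rewrite ltW // mulr_gt0.
  rewrite ler_pdivrMr // -(@ler_pXn2r _ 2) ?nnegrE ?(ltW se0) //.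
  by rewrite /se sqr_sqrtr ltW.
have k0 : 0 <= se / r by rewrite divr_ge0 // ltW.
have kA : se / r * A <= barrier_exp p / 16.
  have := ler_wpM2r (ltW A0) sek; by rewrite [kap * A]divfK // gt_eqF.
have kn : se / r * n%:R <= barrier_exp p / 16.
  by apply: le_trans kA; rewrite ler_wpM2l.
have ks : se / r * p * barrier_width p <= barrier_exp p / 4.
  have : se / r * (p * barrier_width p) <= se / r * A by rewrite ler_wpM2l.
  lra.
pose D := 2 * r * se; have D0 : 0 < D by rewrite !mulr_gt0.
have inside y : sqn (y - c) < r ^+ 2 -> v y <= E * (lam^-1 + barrier_top p) +
    E * ((r ^+ 2 - sqn (y - c)) / D) ^+ 2 / 8.
  move=> yB; set th := (r ^+ 2 - _) / D.
  have th0 : 0 < th by rewrite divr_gt0 // subr_gt0.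
  have tp : 0 <= E * (th `^ barrier_exp p / barrier_exp p).
    apply: mulr_ge0; first exact: ltW.
    by apply: divr_ge0; [exact: powR_ge0|exact: ltW].
  have S0 : 0 < barrier_width p ^+ 2 / (32 * p ^+ 2).
    have p0 : 0 < p by lra.
    by apply: divr_gt0; [exact: exprn_gt0|rewrite mulr_gt0 // exprn_gt0].
  have h e : 0 < e <= barrier_width p ^+ 2 / (32 * p ^+ 2) ->
      v y - E * (lam^-1 + barrier_top p - th `^ barrier_exp p / barrier_exp p + th ^+ 2 / 8)
      <= e * (E * (- ln (th / barrier_width p) + th / barrier_width p - 1)).
    move=> /andP[et0 etS].
    have := ball_barrier p2 lam0 r0 e0 sol BO et0 etS kn ks yB.
    rewrite -/E -/se -/D -/th /barrier; lra.
  have := le0_of_small S0 h; lra.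
have top : v x <= E * (lam^-1 + barrier_top p); last first.
  apply: le_trans top _; rewrite ler_pM2l // lerD2l; exact: barrier_top_le.
rewrite leNgt; apply/negP => vx; set e := v x - E * (lam^-1 + barrier_top p).
have ee : 0 < e by rewrite subr_gt0.
have clB := closed_ball_closure r0 (fun y h => (BO y h).1).
have [/subspace_continuousP cv _] := sol.
have xcl : closure O x by apply: clB; rewrite xr.
have vlt : v x - e / 2 < v x by lra.
have /(cvgr_gt _)/(_ _ vlt) := cv x xcl.
move=> /near_sqn_ball[d d0 hd].
(* On the radius from x towards c, th <= t Q because 1 - (1 - t)^2 <= 2 t. For small t the quadratic
   remainder is below e / 8, while continuity loses only e / 2. *)
pose Q := 2 * r ^+ 2 / D.
have Q0 : 0 < Q by rewrite divr_gt0 // mulr_gt0 // exprn_gt0.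
have W0 : 0 < E * Q ^+ 2 by rewrite mulr_gt0 // exprn_gt0.
have [t [t0 [t1 [td tQ]]]] := filter_ex (filterI (nbhs_right_gt (0 : R))
  (filterI (nbhs_right_lt ltr01) (filterI (nbhs_right_lt (divr_gt0 d0 r0))
   (nbhs_right_lt (divr_gt0 ee W0))))).
rewrite /= in t0 t1 td tQ.
rewrite ltr_pdivlMr // in td; rewrite ltr_pdivlMr // in tQ.
have r20 : 0 < r ^+ 2 by exact: exprn_gt0.
have [q1 q2] := ball_segment t xr; set y := x + t *: (c - x) in q1 q2.
have yB : sqn (y - c) < r ^+ 2.
  by rewrite q1 gtr_pMl // expr_lt1 //; lra.
have := hd y; rewrite q2 -exprMn ltr_pXn2r ?nnegrE ?mulr_ge0 ?(ltW t0) ?(ltW r0) ?(ltW d0) // => /(_ td (clB _ (ltW yB))) vy.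
have {}vy : v x - e / 2 < v y := vy.
have := inside y yB.
have thQ : 0 <= (r ^+ 2 - sqn (y - c)) / D <= t * Q.
  rewrite divr_ge0 ?subr_ge0 ?(ltW yB) ?(ltW D0) //= /Q mulrA ler_pM2r ?invr_gt0 // q1.
  have : 0 <= t ^+ 2 * r ^+ 2 by rewrite mulr_ge0 ?sqr_ge0 // ltW.
  lra.
move: thQ => /andP[w0 wQ].
have : ((r ^+ 2 - sqn (y - c)) / D) ^+ 2 <= t * Q ^+ 2.
  apply: (@le_trans _ _ ((t * Q) ^+ 2)).
    by rewrite ler_pXn2r ?nnegrE // mulr_ge0 // ltW.
  rewrite exprMn; apply: ler_wpM2r; first by rewrite ltW // exprn_gt0.
  rewrite expr2 ler_piMl //; exact: ltW.
move=> /(ler_wpM2l (ltW E0)); move: tQ vy; rewrite /e; lra.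
Qed.

End BallEstimate.

(** * Mean value formulas along coordinate paths *)

Section CoordinateMVT.
Context {R : realType} {n : nat}.
Notation V := 'rV[R]_n.
Implicit Types (x y z w v : V) (g : V -> R) (rho : R).

Lemma norm_rV_lt v rho : 0 < rho -> (forall i, `|v 0 i| < rho) -> `|v| < rho.
Proof.
move=> r0 h; have -> : `|v| = mx_norm v by [].
have [->//|/mx_norm_neq0[[j i] ->]] := eqVneq (mx_norm v) 0.
by rewrite (ord1 j).
Qed.

Lemma norm_rV_le v rho : 0 <= rho -> (forall i, `|v 0 i| <= rho) -> `|v| <= rho.
Proof.
move=> r0 h; have -> : `|v| = mx_norm v by [].
have [->//|/mx_norm_neq0[[j i] ->]] := eqVneq (mx_norm v) 0.
by rewrite (ord1 j).
Qed.

Lemma is_derive_line g w v (t : R) : derivable g (t *: v + w) v ->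
  is_derive t 1 (fun s => g (s *: v + w)) ('D_v g (t *: v + w)).
Proof.
move=> dg.
have E : (fun h : R => h^-1 *: (((fun s => g (s *: v + w)) \o shift t) (h *: 1) - g (t *: v + w)))
   = (fun h : R => h^-1 *: ((g \o shift (t *: v + w)) (h *: v) - g (t *: v + w))).
  apply/funext => h /=; congr (_ *: (g _ - _)).
  by rewrite [h *: (1 : R)]mulr1 scalerDl addrA.
by apply: DeriveDef; rewrite /derivable /derive E.
Qed.

Lemma coordinate_mvt g w (i : 'I_n) (s : R) :
  (forall t, 0 <= t <= 1 -> derivable g ((t * s) *: evec R i + w) (evec R i)) ->
  exists2 t, 0 <= t <= 1 &
    g (s *: evec R i + w) - g w = s * partial g i ((t * s) *: evec R i + w).
Proof.
move=> dg.
have d (t : R) : 0 <= t <= 1 -> is_derive t (1 : R) (fun t => g ((t * s) *: evec R i + w))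
    (partial g i ((t * s) *: evec R i + w) * s).
  move=> t01; have d1 := is_derive_line (dg t t01).
  have d2 : is_derive t (1 : R) (fun t : R => t * s) s.
    by apply: is_derive_eq; rewrite /GRing.scale /= mulr0 add0r mulr1.
  exact: (is_derive1_comp (f := fun t => g (t *: evec R i + w)) (g := fun t => t * s) d1 d2).
have [||c] := @MVT_segment R (fun t => g ((t * s) *: evec R i + w)) (fun t => partial g i ((t * s) *: evec R i + w) * s) _ _ ler01.
- by move=> t; rewrite in_itv /= => /andP[t0 t1]; apply: d; rewrite !ltW.
- apply: derivable_within_continuous => t; rewrite in_itv /= => /d t01.
  by have [] := t01.
rewrite in_itv /= => c01; rewrite mul1r mul0r scale0r add0r subr0 mulr1 mulrC => E.
by exists c.
Qed.

(** Smoothness is given through coordinate derivatives only, so the increment is split along a path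
    changing one coordinate at a time. Each coordinate of the path is a convex combination of those
    of x and y, hence the path stays in every max-norm ball containing both. *)
Lemma path_mvt g (x0 : V) rho x y :
  (forall z (i : 'I_n), `|z - x0| < rho -> derivable g z (evec R i)) ->
  `|x - x0| < rho -> `|y - x0| < rho ->
  exists2 z : 'I_n -> V, (forall i, `|z i - x0| < rho /\ `|z i - x| <= `|y - x|) &
    g y - g x = \sum_(i < n) (y - x) 0 i * partial g i (z i).
Proof.
move=> dg xr yr; have r0 : 0 < rho by apply: le_lt_trans xr.
pose w (k : nat) : V := \row_j (if (j < k)%N then y 0 j else x 0 j).
have w0 : w 0%N = x by apply/rowP => j; rewrite mxE.
have wn : w n = y by apply/rowP => j; rewrite mxE ltn_ord.
have wS (i : 'I_n) : w i.+1 = (y - x) 0 i *: evec R i + w i.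
  apply/rowP => j; rewrite !mxE ltnS leq_eqVlt eqxx /= -val_eqE /=.
  have [ji|ij|ji] := ltngtP j i; rewrite ?mulr0 ?add0r ?mulr1 //.
  have -> : j = i by exact: val_inj.
  by rewrite subrK.
have zc (i j : 'I_n) (t : R) : 0 <= t <= 1 ->
   exists2 s, 0 <= s <= 1 & ((t * (y - x) 0 i) *: evec R i + w i) 0 j = (1 - s) * x 0 j + s * y 0 j.
  move=> t01; rewrite !mxE eqxx /= -val_eqE /=.
  have [ji|ij|ji] := ltngtP j i.
  - by exists 1; rewrite ?ler01 ?lexx //= mulr0; ring.
  - by exists 0; rewrite ?ler01 ?lexx //= mulr0; ring.
  - have -> : j = i by exact: val_inj.
    by exists t => //=; rewrite mulr1; ring.
have sub (a b : V) j : (a - b) 0 j = a 0 j - b 0 j by rewrite !mxE.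
have zin (i : 'I_n) (t : R) : 0 <= t <= 1 ->
   `|(t * (y - x) 0 i) *: evec R i + w i - x0| < rho /\
   `|(t * (y - x) 0 i) *: evec R i + w i - x| <= `|y - x|.
  move=> t01; split.
    apply: norm_rV_lt => // j; have [s /andP[s0 s1] E] := zc i j t t01.
    rewrite (sub _ x0) E.
    have hx := le_lt_trans (coord_le_norm (x - x0) j) xr.
    have hy := le_lt_trans (coord_le_norm (y - x0) j) yr.
    rewrite !sub in hx hy.
    have -> : (1 - s) * x 0 j + s * y 0 j - x0 0 j =
      (1 - s) * (x 0 j - x0 0 j) + s * (y 0 j - x0 0 j) by ring.
    set m := Num.max `|x 0 j - x0 0 j| `|y 0 j - x0 0 j|.
    have mr : m < rho by rewrite gt_max hx hy.
    apply: le_lt_trans mr; apply: le_trans (ler_normD _ _) _.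
    have s1' : 0 <= 1 - s by lra.
    rewrite !normrM (ger0_norm s0) (ger0_norm s1').
    have ha : `|x 0 j - x0 0 j| <= m by rewrite le_max lexx.
    have hb : `|y 0 j - x0 0 j| <= m by rewrite le_max lexx orbT.
    have := ler_wpM2l s1' ha; have := ler_wpM2l s0 hb; lra.
  apply: norm_rV_le => // j; have [s /andP[s0 s1] E] := zc i j t t01.
  rewrite (sub _ x j) E.
  have hy := coord_le_norm (y - x) j; rewrite sub in hy.
  have -> : (1 - s) * x 0 j + s * y 0 j - x 0 j = s * (y 0 j - x 0 j) by ring.
  rewrite normrM (ger0_norm s0); apply: le_trans hy; exact: ler_piMl.
have step (i : 'I_n) : exists z, (`|z - x0| < rho /\ `|z - x| <= `|y - x|) /\
    g (w i.+1) - g (w i) = (y - x) 0 i * partial g i z.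
  have [t01 //|t t01 E] := @coordinate_mvt g (w i) i ((y - x) 0 i).
    by move=> ht; apply: dg; exact: (zin i t01 ht).1.
  by exists ((t * (y - x) 0 i) *: evec R i + w i); rewrite wS; split => //; exact: zin.
have [z hz] := choice step; exists z; first by move=> i; exact: (hz i).1.
rewrite -(eq_bigr _ (fun i _ => (hz i).2)) -{1}wn -{1}w0.
rewrite -(big_mkord xpredT (fun k => g (w k.+1) - g (w k))).
by rewrite telescope_sumr.
Qed.

End CoordinateMVT.

(** * Uniform interior ball condition *)

Section InteriorBall.
Context {R : realType} {n : nat}.
Notation V := 'rV[R]_n.
Implicit Types (O : set V) (x y z c : V) (rho r : R).

Lemma sum_mul_le (a b : 'I_n -> R) (A B : R) :
  (forall i, `|a i| <= A) -> (forall i, `|b i| <= B) ->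
  `|\sum_(i < n) a i * b i| <= n%:R * (A * B).
Proof.
move=> ha hb; apply: le_trans (ler_norm_sum _ _ _) _.
apply: (@le_trans _ _ (\sum_(i < n) A * B)).
  by apply: ler_sum => i _; rewrite normrM; apply: ler_pM.
by rewrite sumr_const card_ord mulr_natl.
Qed.

Lemma box_lipschitz (g : V -> R) (x0 : V) rho (M : R) x y :
  (forall z (i : 'I_n), `|z - x0| < rho -> derivable g z (evec R i)) ->
  (forall z (i : 'I_n), `|z - x0| < rho -> `|partial g i z| <= M) ->
  `|x - x0| < rho -> `|y - x0| < rho -> `|g y - g x| <= n%:R * (`|y - x| * M).
Proof.
move=> dg gM xr yr; have [z hz ->] := path_mvt dg xr yr.
by apply: sum_mul_le => i; [exact: coord_le_norm|exact: gM (hz i).1].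
Qed.

(** Apply the path formula to g, then the Lipschitz bound to each partial derivative between its
    intermediate point and x. *)
Lemma box_taylor (g : V -> R) (x0 : V) rho (M : R) x y : 0 <= M ->
  (forall z (i : 'I_n), `|z - x0| < rho -> derivable g z (evec R i)) ->
  (forall z (i j : 'I_n), `|z - x0| < rho -> derivable (partial g i) z (evec R j)) ->
  (forall z (i j : 'I_n), `|z - x0| < rho -> `|partial (partial g i) j z| <= M) ->
  `|x - x0| < rho -> `|y - x0| < rho ->
  g y <= g x + dot (grad g x) (y - x) + n%:R * (n%:R * M) * sqn (y - x).
Proof.
move=> M0 dg ddg gM xr yr; have [z hz E] := path_mvt dg xr yr.
have gE : dot (grad g x) (y - x) = \sum_(i < n) (y - x) 0 i * partial g i x.
  by apply: eq_bigr => i _; rewrite mxE mulrC.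
have D : g y - g x - dot (grad g x) (y - x) =
    \sum_(i < n) (y - x) 0 i * (partial g i (z i) - partial g i x).
  by rewrite E gE -sumrB; apply: eq_bigr => i _; rewrite mulrBr.
have dz i : `|partial g i (z i) - partial g i x| <= n%:R * (`|y - x| * M).
  apply: le_trans (box_lipschitz (ddg^~ i) (fun w j => gM w i j) xr (hz i).1) _.
  by apply: ler_wpM2l => //; apply: ler_wpM2r => //; exact: (hz i).2.
have := sum_mul_le (coord_le_norm (y - x)) dz; rewrite -D => h.
have {h} := le_trans (ler_norm _) h.
have -> : n%:R * (`|y - x| * (n%:R * (`|y - x| * M))) = n%:R * (n%:R * M) * `|y - x| ^+ 2 by ring.
have : n%:R * (n%:R * M) * `|y - x| ^+ 2 <= n%:R * (n%:R * M) * sqn (y - x).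
  by apply: ler_wpM2l; [rewrite !mulr_ge0|exact: norm_le_sqn].
lra.
Qed.

(** Here N = |h|^2 and s is the component of h along the normal. Being in the tangent ball means s <
    - N / (2 r), and for small r the linear descent G s beats the Taylor remainder L N. *)
Lemma quadratic_descent (G r L N s : R) : 0 < G -> N + 2 * r * s < 0 ->
  r * (2 * L + 1) < G -> 0 <= N -> 0 < r -> 2 * r * (G * s + L * N) < 0.
Proof.
move=> G0 h1 h2 N0 r0.
have e1 : G * (N + 2 * r * s) < 0 by rewrite pmulr_rlt0.
have e2 : 0 <= (G - r * (2 * L + 1)) * N by rewrite mulr_ge0 // subr_ge0 ltW.
have e3 : 0 <= r * N by rewrite mulr_ge0 // ltW.
lra.
Qed.

(** The ball is tangent at x with centre x - r nu, nu being the normalised gradient of the defining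
    function. Bounds on its derivatives near x0 make the admissible radii uniform in x. *)
Lemma interior_ball_local O x0 : C2_boundary O -> closure O x0 -> ~ O x0 ->
  exists2 rho, 0 < rho & forall x r, `|x - x0| < rho -> closure O x -> ~ O x ->
    0 < r < rho -> exists2 c, sqn (x - c) = r ^+ 2 &
      forall y, sqn (y - c) < r ^+ 2 -> O y.
Proof.
move=> C2O x0c x0O; have [r0 [r00 [g [[Cg Cdg] [gn0 gO]]]]] := C2O x0 x0c x0O.
have x0r : enorm (x0 - x0) < r0 by rewrite subrr enorm_ltE // sqn0 exprn_gt0.
pose M : R := 1 + \sum_(i < n) `|partial g i x0| +
   \sum_(i < n) \sum_(j < n) `|partial (partial g i) j x0|.
have S1 : 0 <= \sum_(i < n) `|partial g i x0| by apply: sumr_ge0.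
have S2 : 0 <= \sum_(i < n) \sum_(j < n) `|partial (partial g i) j x0|.
  by apply: sumr_ge0 => i _; apply: sumr_ge0.
have M1 i : `|partial g i x0| < M.
  have : `|partial g i x0| <= \sum_(i < n) `|partial g i x0|.
    by rewrite (bigD1 i) //= lerDl sumr_ge0.
  rewrite /M; lra.
have M2 i j : `|partial (partial g i) j x0| < M.
  have h1 : `|partial (partial g i) j x0| <= \sum_(j < n) `|partial (partial g i) j x0|.
    by rewrite (bigD1 j) //= lerDl sumr_ge0.
  have : \sum_(j < n) `|partial (partial g i) j x0| <=
      \sum_(i < n) \sum_(j < n) `|partial (partial g i) j x0|.
    rewrite [leRHS](bigD1 i) //= lerDl; apply: sumr_ge0 => k _; exact: sumr_ge0.
  rewrite /M; lra.
have M0 : 0 < M by rewrite /M; lra.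
pose gam := sqn (grad g x0) / 2.
have G0 : 0 < sqn (grad g x0) by apply: sqn_gt0; exact: gn0.
have gam0 : 0 < gam by rewrite divr_gt0.
have n1 : \forall z \near x0, enorm (z - x0) < r0.
  have := nbhs_sqn x0 (exprn_gt0 2 r00); apply: filterS => z.
  by rewrite enorm_ltE.
have n2 : \forall z \near x0, forall i, `|partial g i z| < M.
  apply: (@filter_forall V 'I_n (fun i z => `|partial g i z| < M) (nbhs x0)) => i.
  have [_ c] := Cg i x0 x0r.
  exact: (cvgr_norm_lt _ c _ (M1 i)).
have n3 : \forall z \near x0, forall i j, `|partial (partial g i) j z| < M.
  apply: (@filter_forall V 'I_n (fun i z => forall j, `|partial (partial g i) j z| < M) (nbhs x0)) => i.
  apply: (@filter_forall V 'I_n (fun j z => `|partial (partial g i) j z| < M) (nbhs x0)) => j.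
  have [_ c] := Cdg i j x0 x0r.
  exact: (cvgr_norm_lt _ c _ (M2 i j)).
have n4 : \forall z \near x0, gam < sqn (grad g z).
  have c : {for x0, continuous (fun z => sqn (grad g z))}.
    have -> : (fun z => sqn (grad g z)) = \sum_(i < n) (fun z => partial g i z * partial g i z).
      apply/funext => z; rewrite fct_sumE; apply: eq_bigr => i _; by rewrite mxE.
    apply: (big_ind (fun h : V -> R => {for x0, continuous h})).
    - exact: cst_continuous.
    - by move=> h k ch ck; apply: continuousD.
    - by move=> i _; have [_ ci] := Cg i x0 x0r; apply: continuousM; exact: ci.
  by apply: (cvgr_gt _ c); rewrite /gam; lra.
have n1234 : \forall z \near x0, (enorm (z - x0) < r0 /\ forall i, `|partial g i z| < M) /\
    ((forall i j, `|partial (partial g i) j z| < M) /\ gam < sqn (grad g z)).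
  exact: filterI (filterI n1 n2) (filterI n3 n4).
move: n1234 => /nbhs_ballP[rho /= rho0 hrho].
have box z : `|z - x0| < rho -> [/\ enorm (z - x0) < r0, forall i, `|partial g i z| <= M,
    forall i j, `|partial (partial g i) j z| <= M & gam < sqn (grad g z)].
  move=> zr; have [|[a b] [c d]] := hrho z.
    by rewrite -ball_normE /= distrC.
  split; [exact: a|by move=> i; exact: ltW (b i)|by move=> i j; exact: ltW (c i j)|exact: d].
have dg z i : `|z - x0| < rho -> derivable g z (evec R i).
  by move=> /box[zr _ _ _]; have [] := Cg i z zr.
have ddg z i j : `|z - x0| < rho -> derivable (partial g i) z (evec R j).
  by move=> /box[zr _ _ _]; have [] := Cdg i j z zr.
have gM1 z i : `|z - x0| < rho -> `|partial g i z| <= M by move=> /box[].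
have gM2 z i j : `|z - x0| < rho -> `|partial (partial g i) j z| <= M by move=> /box[].
(* The sign passes from O to its closure by the Lipschitz bound on g. *)
have gle0 x : `|x - x0| < rho -> closure O x -> g x <= 0.
  move=> xr xc; rewrite leNgt; apply/negP => gx0.
  have nM0 : 0 < n%:R * M + 1 by rewrite ltr_wpDl // mulr_ge0 // ltW.
  pose d := Num.min (rho - `|x - x0|) (g x / (n%:R * M + 1)).
  have d0 : 0 < d by rewrite lt_min subr_gt0 xr divr_gt0.
  have [y [Oy]] := xc _ (nbhsx_ballx x d d0).
  rewrite -ball_normE /= distrC lt_min => /andP[y1 y2].
  have yr : `|y - x0| < rho.
    by have := ler_distD x y x0; lra.
  have [yr0 _ _ _] := box y yr.
  have gy : g y < 0 by apply/gO.
  have := le_trans (ler_norm _) (box_lipschitz dg gM1 yr xr).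
  rewrite distrC; move: y2; rewrite ltr_pdivlMr //.
  have := normr_ge0 (y - x); lra.
clear S1 S2 M1 M2 n1 n2 n3 n4 hrho.
pose L := n%:R * (n%:R * M).
have L0 : 0 <= L by rewrite !mulr_ge0 // ltW.
pose g0 := Num.sqrt gam; have g00 : 0 < g0 by rewrite sqrtr_gt0.
(* The first bound keeps the tangent ball, of diameter 2 r, inside the box; the second is the
   smallness required by [quadratic_descent]. *)
exists (Num.min (rho / 4) (g0 / (2 * L + 1))).
  by rewrite lt_min !divr_gt0 //; lra.
move=> x r; rewrite lt_min => /andP[xr _] xc xO /andP[rr0]; rewrite lt_min => /andP[rr1 rr2].
have xr' : `|x - x0| < rho by lra.
have [_ _ _ gx] := box x xr'.
pose G := Num.sqrt (sqn (grad g x)).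
have Gg : g0 < G by rewrite ltr_sqrt //; lra.
have GG : G ^+ 2 = sqn (grad g x) by rewrite sqr_sqrtr // sqn_ge0.
have Gp : 0 < G by lra.
pose nu := G^-1 *: grad g x.
have nu1 : sqn nu = 1 by rewrite sqnZ -GG -exprMn mulVf ?expr1n // gt_eqF.
exists (x - r *: nu); first by rewrite subKr sqnZ nu1 mulr1.
move=> y; have -> : y - (x - r *: nu) = (y - x) + r *: nu by rewrite opprB addrCA addrC.
move=> yB; set h := y - x in yB.
have hr : sqn h < (2 * r) ^+ 2.
  have -> : h = (h + r *: nu) + - (r *: nu) by rewrite addrK.
  apply: le_lt_trans (sqnD_le _ _) _; rewrite sqnN (sqnZ r) nu1 exprMn; lra.
have r20 : 0 < 2 * r by lra.
have hn := norm_lt_sqn r20 hr.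
have yr : `|y - x0| < rho.
  by have := ler_distD x y x0; rewrite -/h; lra.
have [yr0 _ _ _] := box y yr.
apply/(gO _ yr0).
have T := box_taylor (ltW M0) dg ddg gM2 xr' yr; rewrite -/h -/L in T.
apply: le_lt_trans T _.
have gx0 := gle0 x xr' xc.
move: yB; rewrite sqnD sqnZ nu1 dotZr mulr1 => yB.
have gE : dot (grad g x) h = G * dot h nu.
  by rewrite /nu dotZr mulrA mulfV ?gt_eqF // mul1r dotC.
have hN := sqn_ge0 h.
have h1 : sqn h + 2 * r * dot h nu < 0 by lra.
have rL : r * (2 * L + 1) < G.
  by move: rr2; rewrite ltr_pdivlMr; lra.
have h2 : 2 * r * (G * dot h nu + L * sqn h) < 0 := quadratic_descent Gp h1 rL hN rr0.
have : G * dot h nu + L * sqn h < 0 by rewrite -(pmulr_rlt0 _ r20).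
rewrite gE; lra.
Qed.

Lemma compact_closure_bounded O : bounded_set O -> compact (closure O).
Proof.
move=> [M [_ hM]].
have hO y : O y -> `|y| <= M + 1 by apply: hM; rewrite ltrDl.
pose K := [set y : V | sqn (y - 0) <= n%:R * (M + 1) ^+ 2].
have cK : compact K by exact: compact_sqn_ball.
have OK : O `<=` K.
  move=> y /hO yM; rewrite /K /= subr0; apply: le_trans (sqn_le_norm _) _.
  by apply: ler_wpM2l => //; rewrite ler_pXn2r ?nnegrE // (le_trans _ yM).
have clK : closure O `<=` K.
  have /closure_id -> : closed K by apply: compact_closed => //; exact: norm_hausdorff.
  exact: closure_subset.
by apply: (subclosed_compact _ cK clK); exact: closed_closure.
Qed.

(** Locally every small radius works, so compactness of the boundary yields a common one, as small
    as desired; it is later taken small enough to avoid the support of f. *)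
Lemma interior_ball O (d : R) : open O -> bounded_set O -> C2_boundary O -> 0 < d ->
  exists2 r, 0 < r < d & forall x, closure O x -> ~ O x ->
    exists2 c, sqn (x - c) = r ^+ 2 & forall y, sqn (y - c) < r ^+ 2 -> O y.
Proof.
move=> oO bO C2O d0.
have cK : compact (closure O `\` O).
  apply: (@subclosed_compact _ _ (closure O)) => [||x []//].
    apply: closedI; [exact: closed_closure|exact: open_closedC].
  exact: compact_closure_bounded.
pose P r x := exists2 c, sqn (x - c) = r ^+ 2 & forall y, sqn (y - c) < r ^+ 2 -> O y.
have : \forall r \near 0^'+, closure O `\` O `<=` P r.
  have /compact_near_coveringP/near_covering_withinP := cK.
  apply => x0 [x0c x0O]; have [rho rho0 h] := interior_ball_local C2O x0c x0O.
  exists ([set x | `|x - x0| < rho], [set r | 0 < r /\ r < rho]) => /=.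
    split; first by apply/nbhs_ballP; exists rho => // y; rewrite -ball_normE /= distrC.
    exact: (filterI (nbhs_right_gt (0 : R)) (nbhs_right_lt rho0)).
  by move=> [x r] /= [xr [rr1 rr2]] [xc xO]; apply: h => //; rewrite rr1.
move=> near_r.
have [r [r0 [rd hr]]] := filter_ex (filterI (nbhs_right_gt (0 : R)) (filterI (nbhs_right_lt d0) near_r)).
exists r; first by rewrite r0.
by move=> x xc xO; exact: hr.
Qed.

End InteriorBall.

(** * Extension by zero *)

Section ZeroExtension.
Context {R : realType} {n : nat}.
Notation V := 'rV[R]_n.
Implicit Types (x y z h q : V) (O S : set V) (g f u : V -> R).

Definition zero_ext O g x : R := if pselect (O x) then g x else 0.

Lemma zero_ext_in O g x : O x -> zero_ext O g x = g x.
Proof. by rewrite /zero_ext; case: pselect. Qed.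

Lemma zero_ext_out O g x : ~ O x -> zero_ext O g x = 0.
Proof. by rewrite /zero_ext; case: pselect. Qed.

Lemma continuous_zero_ext O S g : open O -> closed S -> S `<=` O ->
  {within closure O, continuous g} -> (forall x, O x -> ~ S x -> g x = 0) ->
  continuous (zero_ext O g).
Proof.
move=> oO cS SO /subspace_continuousP cg g0 x.
have [Ox|nOx] := pselect (O x).
  have nx : \forall y \near x, O y by exact: open_nbhs_nbhs.
  have cgx : g @ x --> g x.
    have := cg x (subset_closure Ox); rewrite within_interior //.
    by rewrite /interior /=; apply: filterS nx; exact: subset_closure.
  rewrite /continuous_at (zero_ext_in g Ox).
  have e : \forall y \near x, zero_ext O g y = g y.
    by apply: filterS nx => y Oy; rewrite zero_ext_in.
  move=> P /cgx gP; apply: filterS2 e gP => y /= e Pg.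
  by rewrite e.
rewrite /continuous_at (zero_ext_out g nOx).
have nS : \forall y \near x, (~` S) y.
  by apply: open_nbhs_nbhs; split; [exact: closed_openC|move=> /SO].
move=> P /nbhs_singleton P0; apply: filterS nS => y nSy /=.
have [Oy|nOy] := pselect (O y); first by rewrite zero_ext_in // g0.
by rewrite zero_ext_out.
Qed.

Lemma compact_subset_margin O S : open O -> compact S -> S `<=` O ->
  exists2 d, 0 < d & forall x y, S x -> sqn (y - x) < d -> O y.
Proof.
move=> oO cS SO.
have : \forall d \near (0 : R)^'+, S `<=` [set x | forall y, sqn (y - x) < d -> O y].
  have /compact_near_coveringP := cS; apply => x0 /SO Ox0.
  have /near_sqn_ball[r r0 hr] : \forall y \near x0, O y by exact: open_nbhs_nbhs.
  have r2 : 0 < r ^+ 2 by exact: exprn_gt0.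
  exists ([set x | sqn (x - x0) < r ^+ 2 / 4], [set d | d < r ^+ 2 / 4]) => /=.
    split; first by apply: nbhs_sqn; lra.
    by apply: nbhs_right_lt; lra.
  move=> [x d] /= [xx0 dr] y xy; apply: hr.
  have -> : y - x0 = (y - x) + (x - x0) by rewrite addrA subrK.
  apply: le_lt_trans (sqnD_le _ _) _; lra.
move=> near_d.
have [d [d0 hd]] := filter_ex (filterI (nbhs_right_gt (0 : R)) near_d).
by exists d => // x y Sx; exact: hd.
Qed.

Lemma support_inP O f x : closure O x -> ~ support_in O f x -> f x = 0.
Proof.
move=> Ox nS; apply/eqP; apply: contrapT => /negP f0; apply: nS.
by apply: subset_closure.
Qed.

(** A large h is handled by boundedness, which costs 8 M / d. For small h, either an end point lies
    in the support and the whole segment is inside O, or both outer values vanish and the second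
    difference is at most 0. *)
Lemma midpoint_semiconcave_zero_ext O f : open O -> bounded_set O ->
  {within closure O, continuous f} -> (forall x, closure O x -> 0 <= f x) ->
  compact (support_in O f) -> support_in O f `<=` O -> semiconcave_on O f ->
  exists2 K, 0 < K & midpoint_semiconcave K (zero_ext O f).
Proof.
move=> oO bO cf f0 cS SO [K hK].
have [d d0 hd] := compact_subset_margin oO cS SO.
have F0 x : 0 <= zero_ext O f x.
  have [Ox|nOx] := pselect (O x); last by rewrite zero_ext_out.
  by rewrite zero_ext_in // f0 //; exact: subset_closure.
have FS x : ~ support_in O f x -> zero_ext O f x = 0.
  move=> nS; have [Ox|nOx] := pselect (O x); last by rewrite zero_ext_out.
  by rewrite zero_ext_in //; apply: support_inP nS; exact: subset_closure.
have [M M0 hM] : exists2 M, 0 < M & forall x, zero_ext O f x <= M.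
  have [S0|/set0P S0] := eqVneq (support_in O f) set0.
    by exists 1 => // x; rewrite FS ?ler01 // S0.
  have [|c _ hc] := @compact_max _ _ f (support_in O f) S0 cS.
    by apply: continuous_subspaceW cf => x /SO; exact: subset_closure.
  exists (`|f c| + 1) => [|x]; first by rewrite ltr_wpDl.
  have [Sx|nS] := pselect (support_in O f x); last by rewrite FS ?addr_ge0.
  by rewrite zero_ext_in; [have := hc x Sx; have := ler_norm (f c); lra|exact: SO].
have Md : 0 <= 8 * M / d by rewrite divr_ge0 ?mulr_ge0 ?ltW.
exists (`|K| + 8 * M / d + 1) => [|x h]; first by rewrite ltr_wpDl // addr_ge0.
have hN := sqn_ge0 h; have Fx := F0 x.
have KN : K * sqn h <= `|K| * sqn h by apply: ler_wpM2r => //; exact: ler_norm.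
have KN0 : 0 <= `|K| * sqn h by rewrite mulr_ge0.
have MN0 : 0 <= 8 * M / d * sqn h by rewrite mulr_ge0.
have [hd4|hd4] := leP (d / 4) (sqn h).
  have : 2 * M <= 8 * M / d * sqn h.
    have -> : 2 * M = 8 * M / d * (d / 4) by field; rewrite gt_eqF.
    by apply: ler_wpM2l.
  have := hM (x + h); have := hM (x - h); lra.
(* Points of the segment differ from the end point by at most 2 |h|, and 4 |h|^2 < d, the margin of
   the support. *)
have seg e : `|e| = 1 -> support_in O f (x + e *: h) ->
    forall s : R, 0 <= s <= 1 -> O (s *: (x + h) + (1 - s) *: (x - h)).
  move=> e1 Se s /andP[s0 s1]; apply: (hd _ _ Se).
  have -> : s *: (x + h) + (1 - s) *: (x - h) - (x + e *: h) = (2 * s - 1 - e) *: h.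
    by apply/rowP => i; rewrite !mxE; ring.
  rewrite sqnZ; have ee : -1 <= e <= 1 by rewrite -ler_norml e1.
  have : (2 * s - 1 - e) ^+ 2 <= 4.
    rewrite -[leRHS](_ : 2 ^+ 2 = _); last by rewrite expr2; lra.
    rewrite -real_normK ?num_real // ler_pXn2r ?nnegrE // ler_norml; lra.
  by move=> /(ler_wpM2r hN); lra.
have main : (forall s : R, 0 <= s <= 1 -> O (s *: (x + h) + (1 - s) *: (x - h))) ->
    zero_ext O f (x + h) + zero_ext O f (x - h) - 2 * zero_ext O f x <= K * sqn h.
  move=> Oseg; have half : 0 <= (2^-1 : R) <= 1 by lra.
  have := hK _ _ Oseg _ half; have := Oseg _ half.
  have mid : 2^-1 *: (x + h) + (1 - 2^-1) *: (x - h) = x.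
    by apply/rowP => i; rewrite !mxE; field.
  have dif : x + h - (x - h) = 2 *: h by apply/rowP => i; rewrite !mxE; ring.
  have O1 : O (x + h).
    by have := Oseg 1; rewrite subrr scale1r scale0r addr0; apply; rewrite ler01 lexx.
  have O0 : O (x - h).
    by have := Oseg 0; rewrite subr0 scale1r scale0r add0r; apply; rewrite ler01 lexx.
  rewrite mid dif enorm_sqn sqnZ => Ox.
  rewrite !zero_ext_in //; lra.
have [Sp|nSp] := pselect (support_in O f (x + h)).
  have := main (seg 1 (normr1 _) _); rewrite scale1r => /(_ Sp); lra.
have [Sm|nSm] := pselect (support_in O f (x - h)).
  have := main (seg (-1) _ _); rewrite normrN1 scaleN1r => /(_ erefl Sm); lra.
rewrite (FS _ nSp) (FS _ nSm); lra.
Qed.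

End ZeroExtension.

(** * The first-order solution and its extension *)

Section FirstOrderSolution.
Context {R : realType} {n : nat}.
Notation V := 'rV[R]_n.
Implicit Types (x y z h q : V) (O S : set V) (f u : V -> R) (p lam : R).

(** Test with a constant at a global minimum; the supersolution property is available there even on
    the boundary. *)
Lemma SC_ge0 O lam p f u : 2 < p -> 0 < lam -> bounded_set O ->
  (forall x, closure O x -> 0 <= f x) -> SC_solution O lam p 0 f u ->
  forall x, closure O x -> 0 <= u x.
Proof.
move=> p2 lam0 bO f0 sol x xc; have [cu _] := sol.
have [c cc hc] := compact_EVT_min (ex_intro _ x xc) (compact_closure_bounded bO) cu.
rewrite inE in cc.
apply: le_trans (hc x _); last by rewrite inE.
have := SC_super_quadratic sol (q := 0) (a := 0) cc.
rewrite sqn0 powR0 ?mulr0 ?mul0r ?addr0 ?subr0; last by apply/eqP; lra.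
move=> H; have {}H : f c <= lam * u c.
  apply: H; apply: filterS (nbhs_sqn (0 : V) ltr01) => h _ hcl; rewrite dot0l mul0r !addr0.
  by apply: hc; rewrite inE.
by rewrite -(pmulr_rge0 _ lam0) (le_trans (f0 c cc)).
Qed.

(** If u were positive at a point where f vanishes nearby, a steep paraboloid would touch u from
    above at a point y with u y > 0, and lam u + |q|^p <= 0 would fail there. *)
Lemma SC_eq0_off_support O lam p f u : 2 < p -> 0 < lam -> open O -> bounded_set O ->
  (forall x, closure O x -> 0 <= f x) -> SC_solution O lam p 0 f u ->
  forall x, O x -> ~ support_in O f x -> u x = 0.
Proof.
move=> p2 lam0 oO bO f0 sol x0 Ox0 nS.
have u0 := SC_ge0 p2 lam0 bO f0 sol.
apply/eqP; rewrite eq_le (u0 x0 (subset_closure Ox0)) andbT leNgt; apply/negP => ux0.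
have nO : \forall y \near x0, O y by exact: open_nbhs_nbhs.
have nnS : \forall y \near x0, (~` support_in O f) y.
  by apply: open_nbhs_nbhs; split; [apply: closed_openC; exact: closed_closure|].
have near_x0 : \forall y \near x0, O y /\ ~ support_in O f y by exact: filterI nO nnS.
have [d d0 hd] := near_sqn_ball near_x0.
have d20 : 0 < d ^+ 2 by exact: exprn_gt0.
pose B := [set y | sqn (y - x0) <= d ^+ 2 / 4].
have BO y : B y -> O y /\ ~ support_in O f y by rewrite /B /= => yB; apply: hd; lra.
have B0 : B x0 by rewrite /B /= subrr sqn0; lra.
have [cu _] := sol.
have cuB : {within B, continuous u}.
  by apply: continuous_subspaceW cu => y /BO[Oy _]; exact: subset_closure.
have cB : compact B by exact: compact_sqn_ball.
have [m Bm hm] := compact_max (ex_intro _ x0 B0) cB cuB.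
have um0 : 0 < u m by exact: lt_le_trans ux0 (hm _ B0).
(* Steep enough that on the sphere of radius d / 2 the paraboloid exceeds the maximum of u, so the
   touching point is interior. *)
pose k := 4 * u m / d ^+ 2 + 1.
have kd : u m < k * (d ^+ 2 / 4).
  have -> : k * (d ^+ 2 / 4) = u m + d ^+ 2 / 4.
    by rewrite /k; field; rewrite gt_eqF.
  lra.
pose w y := u y - k * sqn (y - x0).
have cw : {within B, continuous w}.
  apply/subspace_continuousP => y By.
  have /subspace_continuousP/(_ y By) h1 := cuB.
  have cs : {for y, continuous (fun z : V => sqn (z - x0))}.
    apply: (@continuous_sqn _ _ _ (fun z : V => z - x0)).
    by apply: continuousB; [exact: id|exact: cst_continuous].
  have ck : {for y, continuous (cst k * (fun z : V => sqn (z - x0)))}.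
    by apply: continuousM; [exact: cst_continuous|exact: cs].
  exact: cvgB h1 (cvg_within_filter _ ck).
have [y By hy] := compact_max (ex_intro _ x0 B0) cB cw.
have wy : u x0 <= w y by have := hy _ B0; rewrite /w subrr sqn0 mulr0 subr0.
have k0 : 0 < k by rewrite /k ltr_wpDl // divr_ge0 ?mulr_ge0 ?ltW.
have yN := sqn_ge0 (y - x0).
have kN : 0 <= k * sqn (y - x0) by rewrite mulr_ge0 // ltW.
have yin : sqn (y - x0) < d ^+ 2 / 4.
  rewrite ltNge; apply/negP => /(ler_wpM2l (ltW k0)) h.
  by have := hm y By; move: wy; rewrite /w; lra.
have [Oy nSy] := BO y By.
have ny : \forall h \near (0 : V), B (y + h).
  have c : {for (0 : V), continuous (fun h : V => sqn (y + h - x0))}.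
    apply: (@continuous_sqn _ _ _ (fun h : V => y + h - x0)).
    apply: continuousB; last exact: cst_continuous.
    by apply: continuousD; [exact: cst_continuous|exact: id].
  have c0 : sqn (y + 0 - x0) < d ^+ 2 / 4 by rewrite addr0.
  by apply: filterS (cvgr_lt _ c _ c0) => h /ltW.
have := SC_sub_quadratic sol (q := (2 * k) *: (y - x0)) (a := k) Oy.
rewrite (support_inP (subset_closure Oy) nSy) mulr0 !mul0r subr0 => H.
have {}H : lam * u y + sqn ((2 * k) *: (y - x0)) `^ (p / 2) <= 0.
  apply: H; apply: filterS ny => h /hy; rewrite /w => hh _.
  move: hh; rewrite (_ : y + h - x0 = (y - x0) + h); last by rewrite addrAC.
  rewrite sqnD dotZl; lra.
have := powR_ge0 (sqn ((2 * k) *: (y - x0))) (p / 2).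
have : 0 < lam * u y by rewrite mulr_gt0 //; move: wy; rewrite /w; lra.
lra.
Qed.

(** Outside O the extension takes its minimum value 0, so a paraboloid touching from above must have
    slope 0 there. *)
Lemma zero_ext_subsolution O lam p f u x q (k : R) : 2 < p -> 0 < lam -> open O ->
  (forall y, closure O y -> 0 <= u y) -> SC_solution O lam p 0 f u ->
  (forall h, zero_ext O u (x + h) <= zero_ext O u x + dot q h + k * sqn h) ->
  lam * zero_ext O u x + sqn q `^ (p / 2) <= zero_ext O f x.
Proof.
move=> p2 lam0 oO u0 sol hu; have [Ox|nOx] := pselect (O x).
  rewrite !zero_ext_in //; have := SC_sub_quadratic sol (q := q) (a := k) Ox.
  rewrite mulr0 !mul0r subr0; apply; apply: filterS (nbhs_sqn (0 : V) ltr01) => h _ Oxh.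
  by have := hu h; rewrite !zero_ext_in.
rewrite !zero_ext_out // mulr0 add0r.
have U0 y : 0 <= zero_ext O u y.
  have [Oy|nOy] := pselect (O y); last by rewrite zero_ext_out.
  by rewrite zero_ext_in // u0 //; exact: subset_closure.
have hh h : 0 <= dot q h + k * sqn h.
  by have := le_trans (U0 _) (hu h); rewrite (zero_ext_out u nOx) add0r.
have [q0|q0] := eqVneq q 0; first by rewrite q0 sqn0 powR0 //; apply/eqP; lra.
have qN := sqn_gt0 q0.
(* At h = - t q the paraboloid has value t |q|^2 (k t - 1), negative once k t < 1. *)
pose t := (2 * (`|k| + 1))^-1; have t0 : 0 < t by rewrite invr_gt0 mulr_gt0 // ltr_wpDl.
have kt : k * t < 1.
  rewrite ltr_pdivrMr ?mulr_gt0 ?ltr_wpDl // mul1r.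
  by have := ler_norm k; have := normr_ge0 k; lra.
have := hh (- t *: q); rewrite dotZr sqnZ sqrrN -/(sqn q).
have -> : - t * sqn q + k * (t ^+ 2 * sqn q) = (t * sqn q) * (k * t - 1) by ring.
by rewrite pmulr_rge0 ?mulr_gt0 //; lra.
Qed.

Lemma zero_ext_supersolution O lam p f u x q (k : R) : 2 < p -> open O ->
  SC_solution O lam p 0 f u ->
  (forall h, zero_ext O u x + dot q h - k * sqn h <= zero_ext O u (x + h)) ->
  zero_ext O f x <= lam * zero_ext O u x + sqn q `^ (p / 2).
Proof.
move=> p2 oO sol hu; have [Ox|nOx] := pselect (O x); last first.
  by rewrite !zero_ext_out // mulr0 add0r powR_ge0.
rewrite !zero_ext_in //.
have := SC_super_quadratic sol (q := q) (a := - k) (subset_closure Ox).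
rewrite mulr0 !mul0r subr0; apply.
have nO : \forall y \near x, O y by exact: open_nbhs_nbhs.
have [d d0 hd] := near_sqn_ball nO.
apply: filterS (nbhs_sqn (0 : V) (exprn_gt0 2 d0)) => h; rewrite subr0 => hd' _.
have Oxh : O (x + h) by apply: hd; rewrite addrC addKr.
by have := hu h; rewrite !zero_ext_in // mulNr.
Qed.

End FirstOrderSolution.

(** * Comparison of the viscous and limit solutions *)

Section VanishingViscosity.
Context {R : realType} {n : nat}.
Notation V := 'rV[R]_n.
Implicit Types (x y z h q : V) (O : set V) (f u : V -> R) (p lam : R).

Lemma bounded_set_sqn O : bounded_set O -> exists2 rho, 0 < rho & forall x, closure O x -> sqn x < rho.
Proof.
move=> /compact_closure_bounded/compact_bounded[M [_ hM]].
have {}hM x : closure O x -> `|x| <= `|M| + 1.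
  by apply: hM; rewrite ltr_pwDr // ler_norm.
exists (n%:R * (`|M| + 1) ^+ 2 + 1) => [|x /hM xM].
  by rewrite ltr_wpDl // mulr_ge0 // sqr_ge0.
apply: le_lt_trans (sqn_le_norm x) _; rewrite ltr_pwDr // ler_wpM2l //.
by rewrite ler_pXn2r ?nnegrE // addr_ge0.
Qed.

(** The opening of the paraboloid above [ueps] is C / 2 whatever the penalty k, so the viscous term
    costs eps C n, while [sig] covers the difference of f at the two points. The boundary bound B
    disposes of maxima with x on the boundary. *)
Lemma doubling_estimate O lam p eps f (U ueps : V -> R) (C B sig : R) :
  2 < p -> 0 < lam -> 0 <= eps -> open O -> bounded_set O ->
  continuous U -> continuous (zero_ext O f) ->
  (forall x, 0 <= U x) -> (forall x, ~ O x -> U x = 0) ->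
  midpoint_semiconcave C U ->
  (forall x q k, (forall h, U x + dot q h - k * sqn h <= U (x + h)) ->
     zero_ext O f x <= lam * U x + sqn q `^ (p / 2)) ->
  SC_solution O lam p eps f ueps ->
  (forall x, closure O x -> ~ O x -> ueps x <= B) ->
  0 < sig -> eps * C * n%:R + sig <= lam * B ->
  forall x, closure O x -> ueps x - U x <= B.
Proof.
move=> p2 lam0 e0 oO bO cU cF U0 Uout UC Usuper sol bdry sig0 hB z zc.
rewrite leNgt; apply/negP => zB.
have [rho rho0 hrho] := bounded_set_sqn bO.
have out g x : rho <= sqn x -> zero_ext O g x = 0.
  move=> xr; rewrite zero_ext_out // => /subset_closure/hrho; lra.
have Uout' x : rho <= sqn x -> U x = 0.
  by move=> xr; apply: Uout => /subset_closure/hrho; lra.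
have [M M0 hM] := compact_support_bounded cU Uout'.
have {}hM x : U x <= M by apply: le_trans (hM x); exact: ler_norm.
have [d d0 hd] := compact_support_ucont cF (out f) sig0.
(* Comparison with the diagonal gives k |x - y|^2 <= M < k d at the maximum, which brings x and y
   within the modulus of continuity of f. *)
pose k := M / d + 1.
have k0 : 0 < k by rewrite ltr_wpDl // divr_ge0 ?(ltW M0) ?(ltW d0).
have Mkd : M < k * d by rewrite /k mulrDl divfK ?gt_eqF // mul1r ltrDl.
pose K2 := [set y : V | sqn (y - 0) <= 2 * d + 2 * rho].
pose Phi (w : V * V) : R := ueps w.1 - U w.2 - k * sqn (w.1 - w.2).
have cPhi : {within closure O `*` K2, continuous Phi}.
  apply/subspace_continuousP => w wK.
  have [/subspace_continuousP cu _] := sol.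
  have c1 : ueps w'.1 @[w' --> within (closure O `*` K2) (nbhs w)] --> ueps w.1.
    move=> P /(cu w.1 wK.1) hP.
    have nP : \forall x \near w.1, closure O x -> P (ueps x) := hP.
    have c : {for w, continuous (@fst V V)} by exact: cvg_fst.
    have h2 : nbhs w (fun w' => closure O w'.1 -> P (ueps w'.1)) := c _ nP.
    exact: (filterS (fun w' (h : closure O w'.1 -> P (ueps w'.1))
      (k : (closure O `*` K2) w') => h k.1) h2).
  have cf : {for w, continuous (@fst V V)} by exact: cvg_fst.
  have cs : {for w, continuous (@snd V V)} by exact: cvg_snd.
  have c2 : {for w, continuous (U \o @snd V V)} by apply: continuous_comp => //; exact: cU.
  have c3 : {for w, continuous (fun w : V * V => sqn (w.1 - w.2))}.
    by apply: (@continuous_sqn _ _ _ (fun w : V * V => w.1 - w.2)); exact: continuousB.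
  have c4 : {for w, continuous (cst k * (fun w : V * V => sqn (w.1 - w.2)))}.
    by apply: continuousM; [exact: cst_continuous|exact: c3].
  exact: cvgB (cvgB c1 (cvg_within_filter _ c2)) (cvg_within_filter _ c4).
have cK : compact (closure O `*` K2).
  by apply: compact_setX; [exact: compact_closure_bounded|exact: compact_sqn_ball].
have inK2 x : closure O x -> K2 x by move=> /hrho; rewrite /K2 /= subr0; lra.
have [[x y] [/= xc yK] hmax] := compact_max (ex_intro _ (z, z) (conj zc (inK2 z zc))) cK cPhi.
have diag x' : closure O x' -> ueps x' - U x' <= Phi (x, y).
  move=> xc'; have := hmax (x', x') (conj xc' (inK2 x' xc')).
  by rewrite {1}/Phi /= subrr sqn0 mulr0 subr0.
(* Beyond [K2] the penalty exceeds M, so such a y' is worse than the diagonal; y can then be moved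
   freely in the whole space. *)
have gmax x' y' : closure O x' -> Phi (x', y') <= Phi (x, y).
  move=> xc'; have [yK'|yK'] := pselect (K2 y'); first exact: hmax.
  apply: le_trans (diag x' xc').
  have : d < sqn (x' - y').
    have h1 := hrho x' xc'; have h2 := sqnD_le x' (- (x' - y')).
    have e : x' - (x' - y') = y' by rewrite subKr.
    rewrite e sqnN in h2.
    move: yK'; rewrite /K2 /= subr0 => /negP; rewrite -ltNge; lra.
  rewrite -(ltr_pM2l k0) /Phi /= => h.
  have := U0 y'; have := hM x'; lra.
have BPhi : B < Phi (x, y) by exact: lt_le_trans zB (diag z zc).
have kN : 0 <= k * sqn (x - y) by rewrite mulr_ge0 ?sqn_ge0 // ltW.
have close : sqn (x - y) < d.
  rewrite -(ltr_pM2l k0); apply: le_lt_trans Mkd.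
  by have := diag x xc; rewrite /Phi /=; have := U0 y; have := hM x; lra.
have Uy := U0 y.
have [Ox|nOx] := pselect (O x); last first.
  by have := bdry x xc nOx; move: BPhi; rewrite /Phi /=; lra.
pose q := (2 * k) *: (x - y).
have below h : U y + dot q h - k * sqn h <= U (y + h).
  have := gmax x (y + h) xc; rewrite /Phi /=.
  have -> : x - (y + h) = (x - y) - h by rewrite opprD addrA.
  rewrite sqnB /q dotZl; lra.
have sup := Usuper y q k below.
have above := semiconcave_touch UC below.
(* Shifting x and y by the same h leaves the penalty unchanged, so the upper paraboloid of U at y is
   inherited by [ueps] at x. *)
have sub : lam * ueps x + sqn q `^ (p / 2) - 2 * eps * (C / 2) * n%:R <= f x.
  apply: (SC_sub_quadratic sol Ox).
  apply: filterS (nbhs_sqn (0 : V) ltr01) => h _ /subset_closure xh.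
  have := gmax (x + h) (y + h) xh; rewrite /Phi /=.
  have -> : x + h - (y + h) = x - y by rewrite opprD addrACA subrr addr0.
  have := above h; lra.
have Fxy := le_lt_trans (ler_norm _) (hd x y close).
rewrite zero_ext_in // in Fxy.
have : lam * B < lam * (ueps x - U y).
  by rewrite ltr_pM2l //; move: BPhi; rewrite /Phi /=; lra.
lra.
Qed.

End VanishingViscosity.

(** * Choice of constants and conclusion *)

Unset Implicit Arguments. Set Strict Implicit. Set Printing Implicit Defensive.

Theorem theorem1p2 (R : realType) (n : nat) (p lam : R) (Omega : set 'rV[R]_n)
  (f u : 'rV[R]_n -> R) :
  2 < p -> 0 < lam < 1 ->
  open Omega -> bounded_set Omega -> C2_boundary Omega ->
  {within closure Omega, continuous f} ->
  (forall x, closure Omega x -> 0 <= f x) ->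
  compact (support_in Omega f) -> support_in Omega f `<=` Omega ->
  semiconcave_on Omega f ->
  SC_solution Omega lam p 0 f u ->
  let alpha := (p - 2) / (p - 1) in
  exists eps0 : R, 0 < eps0 /\
    forall (eps : R) (ueps : 'rV[R]_n -> R), 0 < eps < eps0 ->
      SC_solution Omega lam p eps f ueps ->
      forall x, closure Omega x ->
        ueps x - u x <= (lam^-1 + 2 `^ alpha / alpha) * eps `^ (1 - alpha / 2).
Proof.
move=> p2 /andP[lam0 _] oO bO C2O cf f0 cS SO fsc sol alpha.
rewrite -[alpha]/(barrier_exp p); have /andP[al0 al1] := barrier_exp01 p2.
have u0 := SC_ge0 p2 lam0 bO f0 sol.
pose U := zero_ext Omega u.
have cSet : closed (support_in Omega f) by exact: closed_closure.
have cU : continuous U.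
  apply: (continuous_zero_ext oO cSet SO sol.1) => x.
  exact: (SC_eq0_off_support p2 lam0 oO bO f0 sol).
have cF : continuous (zero_ext Omega f).
  by apply: (continuous_zero_ext oO cSet SO cf) => x /subset_closure; exact: support_inP.
have U0 x : 0 <= U x.
  have [Ox|nOx] := pselect (Omega x); last by rewrite /U zero_ext_out.
  by rewrite /U zero_ext_in // u0 //; exact: subset_closure.
have [K K0 hK] := midpoint_semiconcave_zero_ext oO bO cf f0 cS SO fsc.
have [rho rho0 hrho] := bounded_set_sqn bO.
have out (g : 'rV[R]_n -> R) x : rho <= sqn x -> zero_ext Omega g x = 0.
  move=> xr; rewrite zero_ext_out // => /subset_closure/hrho; lra.
have super x q k : (forall h, U x + dot q h - k * sqn h <= U (x + h)) ->
    zero_ext Omega f x <= lam * U x + sqn q `^ (p / 2).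
  exact: zero_ext_supersolution p2 oO sol.
have UC : midpoint_semiconcave (K / lam) U.
  apply: (midpoint_semiconcave_transfer lam0 p2 K0 cU cF U0 (out u) (out f) _ super hK).
  by move=> x q k; exact: zero_ext_subsolution p2 lam0 oO u0 sol.
have [d d0 hd] := compact_subset_margin oO cS SO.
(* A ball touching the boundary with diameter 2 r < sqrt d cannot reach the support of f, which
   keeps squared distance d from the complement; so f = 0 in it. *)
have sd0 : 0 < Num.sqrt d / 2 by rewrite divr_gt0 // sqrtr_gt0.
have [r /andP[r0 rd] hr] := interior_ball oO bO C2O sd0.
have r2d : 4 * r ^+ 2 < d.
  have : (2 * r) ^+ 2 < Num.sqrt d ^+ 2.
    by rewrite ltr_pXn2r ?nnegrE ?sqrtr_ge0 ?mulr_ge0 ?(ltW r0) //; lra.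
  by rewrite sqr_sqrtr ?(ltW d0) // exprMn; lra.
have [e1 e10 he1] := ball_estimate (n := n) p2 lam0 r0.
pose c := K / lam * n%:R + 1.
have c0 : 0 < c by rewrite ltr_wpDl // mulr_ge0 // divr_ge0 // ltW.
(* The second threshold makes eps^(alpha / 2) <= 1 / c, that is, c eps <= E. *)
exists (Num.min e1 (c^-1 `^ (2 / barrier_exp p))).
split; first by rewrite lt_min e10 powR_gt0 // invr_gt0.
move=> eps ueps /andP[ep0]; rewrite lt_min => /andP[ee1 ee2] sole x xc.
set E := eps `^ _; have E0 : 0 < E by exact: powR_gt0.
set B := _ * E.
have bdry y : closure Omega y -> ~ Omega y -> ueps y <= B.
  move=> yc nOy; have [z yz hz] := hr y yc nOy.
  rewrite /B mulrC; apply: (he1 Omega f ueps z) => // [|w wz]; first by rewrite ep0.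
  split; first exact: hz.
  apply: support_inP; first exact: subset_closure (hz _ wz).
  move=> Sw; apply: nOy; apply: (hd w) => //.
  have -> : y - w = (y - z) - (w - z) by rewrite opprB addrA subrK.
  apply: le_lt_trans (sqnD_le _ _) _; rewrite sqnN yz; lra.
have xU : U x <= u x.
  have [Ox|nOx] := pselect (Omega x); first by rewrite /U zero_ext_in.
  by rewrite /U zero_ext_out // u0.
(* Of lam B, the part E coming from 1 / lam pays for the viscous term, and this part serves as the
   slack [sig]. *)
have sig0 : 0 < lam * (2 `^ barrier_exp p / barrier_exp p * E).
  by rewrite !mulr_gt0 ?powR_gt0 ?invr_gt0.
have cE : eps * c <= E.
  have small : eps `^ (barrier_exp p / 2) <= c^-1.
    have h : eps `^ (barrier_exp p / 2) <= (c^-1 `^ (2 / barrier_exp p)) `^ (barrier_exp p / 2).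
      apply: ge0_ler_powR; rewrite ?nnegrE ?powR_ge0 //; first by lra.
        exact: ltW.
      exact: ltW.
    apply: le_trans h _; rewrite -powRrM.
    have -> : 2 / barrier_exp p * (barrier_exp p / 2) = 1 by field; rewrite gt_eqF.
    by rewrite powRr1 // invr_ge0 ltW.
  have eE : eps = E * eps `^ (barrier_exp p / 2).
    rewrite /E -powRD ?subrK ?powRr1 ?(ltW ep0) //.
    by rewrite (gt_eqF ep0) implybT.
  rewrite {1}eE -mulrA -[leRHS]mulr1 ler_pM2l //.
  by rewrite -(ler_pM2r c0) mulVf ?gt_eqF // in small.
have hB : eps * (K / lam) * n%:R + lam * (2 `^ barrier_exp p / barrier_exp p * E) <= lam * B.
  have -> : lam * B = E + lam * (2 `^ barrier_exp p / barrier_exp p * E).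
    by rewrite /B; field; rewrite !gt_eqF.
  rewrite lerD2r.
  by apply: le_trans cE; rewrite /c -mulrA ler_pM2l //; lra.
have Uout y : ~ Omega y -> U y = 0 by exact: zero_ext_out.
have := doubling_estimate p2 lam0 (ltW ep0) oO bO cU cF U0 Uout UC super sole bdry sig0 hB xc.
lra.
Qed.
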